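(* Every strongly polycyclic group $G$ admits a $\mathcal Z$-structure. Moreover, if $G$ has Hirsch length $n$, the $\mathcal Z$-structure $(\overline X,Z)$ can be chosen with $Z$ homeomorphic to the sphere $\mathbb S^{n-1}$ (where $\mathbb S^{-1}=\emptyset$).
   Context: A group is strongly polycyclic if it has a subnormal series $G=G_n\rhd G_{n-1}\rhd\cdots\rhd G_0=\{1\}$ with every quotient $G_{i+1}/G_i$ infinite cyclic; the Hirsch length is the number of infinite cyclic factors in such a series. ARs are locally compact separable metrizable contractible ANRs. An action is proper if for every compact $K$, $\{g: gK\cap K\ne\emptyset\}$ is finite, and cocompact if the quotient is compact. A closed $Z\subseteq Y$ is a $\mathcal Z$-set if there is a homotopy $\alpha:Y\times[0,1]\to Y$ with $\alpha_0=\mathrm{id}$ and $\alpha_t(Y)\subseteq Y\setminus Z$ for $t>0$. A family $\mathcal A$ of subsets of a compact space $Y$ is null if for every open cover $\mathcal U$ of $Y$ all but finitely many members of $\mathcal A$ lie in a single element of $\mathcal U$. A $\mathcal Z$-structure on $G$ is a pair $(\overline X,Z)$ with $\overline X$ a compact AR, $Z$ a $\mathcal Z$-set in $\overline X$, $X=\overline X\setminus Z$ carrying a proper cocompact $G$-action, and $\{gK:g\in G\}$ a null family in $\overline X$ for every compact $K\subseteq X$. *)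

(* Defs.v *)
From HB Require Import structures.
From mathcomp Require Import all_boot all_order all_algebra.
From mathcomp Require Import all_classical all_reals.
From mathcomp Require Import topology normedtype Rstruct Rstruct_topology.
Set Implicit Arguments. Unset Strict Implicit. Unset Printing Implicit Defensive.
Import Order.TTheory GRing.Theory Num.Theory.
Local Open Scope classical_set_scope.
Local Open Scope ring_scope.

Notation R := Rdefinitions.R.

Record group := Group {
  gcar :> Type;
  gmul : gcar -> gcar -> gcar;
  ginv : gcar -> gcar;
  gone : gcar;
  gmulA : forall x y z, gmul x (gmul y z) = gmul (gmul x y) z;
  gmul1 : forall x, gmul gone x = x;
  gmulV : forall x, gmul (ginv x) x = gone
}.

Definition gpow (G : group) (g : G) (k : int) : G :=
  match k with
  | Posz m => iter m (gmul g) (gone G)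
  | Negz m => ginv (iter m.+1 (gmul g) (gone G))
  end.

Definition subgroup (G : group) (H : set G) : Prop :=
  H (gone G) /\ (forall x y, H x -> H y -> H (gmul x y)) /\
  (forall x, H x -> H (ginv x)).

Definition normal_in (G : group) (H K : set G) : Prop :=
  forall g h, K g -> H h -> H (gmul (gmul g h) (ginv g)).

Definition infinite_cyclic_quotient (G : group) (K H : set G) : Prop :=
  exists2 t, K t &
    (forall h, K h -> exists k : int, H (gmul (ginv (gpow t k)) h)) /\
    (forall k : int, H (gpow t k) -> k = 0).

Definition sp_series (G : group) (n : nat) (S : nat -> set G) : Prop :=
  S 0%N = [set gone G] /\ S n = setT /\
  (forall i, (i <= n)%N -> subgroup (S i)) /\
  (forall i, (i < n)%N ->
     S i `<=` S i.+1 /\ normal_in (S i) (S i.+1) /\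
     infinite_cyclic_quotient (S i.+1) (S i)).

Definition strongly_polycyclic (G : group) : Prop :=
  exists n S, @sp_series G n S.

Definition hirsch_length (G : group) (n : nat) : Prop :=
  exists S, @sp_series G n S.

Definition metrizable (Y : topologicalType) : Prop :=
  exists d : Y -> Y -> R,
    (forall x y, 0 <= d x y) /\ (forall x y, d x y = 0 <-> x = y) /\
    (forall x y, d x y = d y x) /\
    (forall x y z, d x z <= d x y + d y z) /\
    (forall A : set Y, open A <->
       (forall x, A x -> exists2 e : R, 0 < e & [set y | d x y < e] `<=` A)).

Definition unit_interval : set R := [set t | 0 <= t <= 1].

Definition closed_embedding (Y M : topologicalType) (e : Y -> M) : Prop :=
  continuous e /\ injective e /\ closed (range e) /\
  exists2 h : M -> Y, (forall y, h (e y) = y) & {within range e, continuous h}.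

Definition ANR (Y : topologicalType) : Prop :=
  metrizable Y /\
  forall (M : topologicalType) (e : Y -> M), metrizable M -> closed_embedding e ->
    exists U : set M, [/\ open U, range e `<=` U &
      exists2 r : M -> Y, {within U, continuous r} & (forall y, r (e y) = y)].

Definition locally_compact (Y : topologicalType) : Prop :=
  forall y : Y, exists2 K : set Y, compact K & nbhs y K.

Definition separable (Y : topologicalType) : Prop :=
  exists2 D : set Y, countable D & closure D = setT.

Definition contractible (Y : topologicalType) : Prop :=
  exists (H : Y * R -> Y) (y0 : Y),
    [/\ {within [set p : Y * R | unit_interval p.2], continuous H},
        (forall y, H (y, 0) = y) & (forall y, H (y, 1) = y0)].

Definition AR (Y : topologicalType) : Prop :=
  [/\ locally_compact Y, separable Y, metrizable Y, contractible Y & ANR Y].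

Definition Zset (Y : topologicalType) (Z : set Y) : Prop :=
  closed Z /\
  exists alpha : Y * R -> Y,
    [/\ {within [set p : Y * R | unit_interval p.2], continuous alpha},
        (forall y, alpha (y, 0) = y) &
        (forall y t, 0 < t <= 1 -> ~ Z (alpha (y, t)))].

Definition null_family (Y : topologicalType) (F : set (set Y)) : Prop :=
  forall C : set (set Y), (forall U, C U -> open U) ->
    setT `<=` \bigcup_(U in C) U ->
    finite_set [set A | F A /\ ~ (exists2 U, C U & A `<=` U)].

Definition action_on (G : group) (Y : topologicalType) (X : set Y)
    (act : G -> Y -> Y) : Prop :=
  [/\ forall g x, X x -> X (act g x),
      forall g, {within X, continuous (act g)},
      forall x, X x -> act (gone G) x = x &
      forall g h x, X x -> act (gmul g h) x = act g (act h x)].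

Definition proper_action (G : group) (Y : topologicalType) (X : set Y)
    (act : G -> Y -> Y) : Prop :=
  forall K : set Y, compact K -> K `<=` X ->
    finite_set [set g : G | exists2 x, K x & K (act g x)].

(* the orbit space X/G is compact: every cover of X by G-invariant sets that
   are open in X has a finite subcover (open sets of X/G correspond exactly
   to G-invariant open subsets of X). *)
Definition cocompact_action (G : group) (Y : topologicalType) (X : set Y)
    (act : G -> Y -> Y) : Prop :=
  forall C : set (set Y),
    (forall U, C U -> (exists2 V, open V & U = V `&` X) /\
                      (forall g x, U x -> U (act g x))) ->
    X `<=` \bigcup_(U in C) U ->
    exists D : set (set Y), [/\ finite_set D, D `<=` C & X `<=` \bigcup_(U in D) U].

Definition Z_structure (G : group) (Xbar : topologicalType) (Z : set Xbar) : Prop :=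
  [/\ compact [set: Xbar], AR Xbar, Zset Z &
    exists act : G -> Xbar -> Xbar,
      let X := ~` Z in
      [/\ action_on X act, proper_action X act, cocompact_action X act &
          forall K : set Xbar, compact K -> K `<=` X ->
            null_family [set A | exists g, A = act g @` K]]].

(* the unit sphere S^{n-1} in R^n (empty for n = 0) *)
Definition sphere (n : nat) : set 'rV[R]_n :=
  [set v | \sum_(i < n) (v ord0 i) ^+ 2 = 1].

Definition homeomorphic_sets (A B : topologicalType) (S : set A) (T : set B) : Prop :=
  exists (f : A -> B) (g : B -> A),
    [/\ forall x, S x -> T (f x), forall y, T y -> S (g y),
        forall x, S x -> g (f x) = x & forall y, T y -> f (g y) = y] /\
    {within S, continuous f} /\ {within T, continuous g}.
Arguments sphere n : clear implicits.

(* Main.v *)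
From HB Require Import structures.
Require Import Defs.
From mathcomp Require Import all_boot all_order all_algebra finmap.
From mathcomp Require Import all_classical all_reals.
From mathcomp Require Import topology normedtype numfun realfun.
From mathcomp Require Import Rstruct Rstruct_topology.
From mathcomp Require Import zify ring lra.
Set Implicit Arguments. Unset Strict Implicit. Unset Printing Implicit Defensive.
Import Order.TTheory GRing.Theory Num.Theory.
Import numFieldNormedType.Exports.
Local Open Scope classical_set_scope.
Local Open Scope ring_scope.

(** A strongly polycyclic group [G] has a chain of normal subgroups
    [G = N_0 > N_1 > ... > 1] with [N_i / N_(i+1)] free abelian: let [N_(i+1)] be
    the common kernel of all homomorphisms [N_i -> Z].  Along this chain one
    builds a proper cocompact action of [G / N_i] on [R^d] by iterated Seifert
    fibrations: if [G / N] acts on [R^d] and [N / N' = Z^k], then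
    [g (x, w) = (x A(g) + p_g(w), g w)] defines an action of [G / N'] on
    [R^k x R^d], where the cocycle [p] is obtained by averaging a set-theoretic
    one with a partition of unity of the base.  The diameter of the translates
    of a compact set in the fibre direction is controlled by the position of
    their projection to the base, so conjugating the fibre coordinates by a
    sufficiently slow homeomorphism of [R] makes that diameter sublinear in the
    distance to the origin.  Translates of compact sets are then null in the
    radial compactification of [R^n], a closed ball with boundary sphere. *)

(** * Groups and Hirsch length *)

HB.instance Definition _ (G : group) := gen_eqMixin (gcar G).
HB.instance Definition _ (G : group) := gen_choiceMixin (gcar G).

Lemma gmulV_r (G : group) (x : G) : gmul x (ginv x) = gone G.
Proof.
rewrite -(gmul1 (gmul x _)) -{1}(gmulV (ginv x)) -gmulA.
by rewrite [gmul (ginv x) (gmul _ _)]gmulA gmulV gmul1 gmulV.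
Qed.

Lemma gmul1_r (G : group) (x : G) : gmul x (gone G) = x.
Proof. by rewrite -(gmulV x) gmulA gmulV_r gmul1. Qed.

HB.instance Definition _ (G : group) := isGroup.Build (gcar G)
  (@gmulA G) (@gmul1 G) (@gmul1_r G) (@gmulV G) (@gmulV_r G).

Section GroupBridge.
Variable G : group.
Implicit Types x y t : G.
Local Open Scope group_scope.

Lemma gmulE x y : gmul x y = x * y. Proof. by []. Qed.
Lemma ginvE x : ginv x = x^-1. Proof. by []. Qed.

Lemma gpow_nat t (m : nat) : gpow t m = t ^+ m.
Proof. exact: iter_mulg_1. Qed.

Lemma gpow_negz t (m : nat) : gpow t (Negz m) = t ^- m.+1.
Proof. by rewrite /gpow -/(gpow t m.+1) gpow_nat. Qed.

Lemma gpowS t (k : int) : gpow t (k + 1)%R = gpow t k * t.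
Proof.
case: k => [m|[|m]].
- by rewrite -PoszD addn1 !gpow_nat expgSr.
- by rewrite gpow_negz expg1 mulVg.
have -> : (Negz m.+1 + 1)%R = Negz m by lia.
by rewrite !gpow_negz [t ^+ m.+2]expgS invgM mulgVK.
Qed.

Lemma gpowD t (k l : int) : gpow t (k + l)%R = gpow t k * gpow t l.
Proof.
elim/int_ind: l => [|l IH|l IH].
- by rewrite addr0 /= mulg1.
- by rewrite -addn1 PoszD addrA !gpowS IH mulgA.
have e : (- l.+1%:Z + 1 = - l%:Z)%R by lia.
apply: (@mulIg _ t); rewrite -mulgA -!gpowS -addrA.
by rewrite e.
Qed.

Lemma gpowN t (k : int) : gpow t (- k)%R = (gpow t k)^-1.
Proof. by apply/esym/mulg1_eq; rewrite -gpowD addrN. Qed.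

Variables (N : set G) (sgN : subgroup N).

Lemma subg1 : N 1. Proof. by case: sgN. Qed.
Lemma subgM x y : N x -> N y -> N (x * y).
Proof. by move: sgN => [_ [h _]]; exact: h. Qed.
Lemma subgV x : N x -> N x^-1.
Proof. by move: sgN => [_ [_ h]]; exact: h. Qed.
Lemma subg_gpow t k : N t -> N (gpow t k).
Proof.
move=> Nt; have H (m : nat) : N (t ^+ m).
  by elim: m => [|m IH]; [exact: subg1 | rewrite expgS; exact: subgM].
by case: k => m; [rewrite gpow_nat | rewrite gpow_negz; apply: subgV].
Qed.
End GroupBridge.

Definition hom_on (G : group) (V : zmodType) (N : set G) (f : G -> V) :=
  forall x y, N x -> N y -> f (x * y)%g = f x + f y.

Section HomOn.
Variables (G : group) (V : zmodType) (N : set G) (f : G -> V).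
Hypotheses (sgN : subgroup N) (fM : hom_on N f).

Lemma hom_on1 : f 1%g = 0.
Proof.
apply: (@addrI _ (f 1%g)).
by rewrite -fM ?mulg1 ?addr0 //; exact: subg1.
Qed.

Lemma hom_onV x : N x -> f x^-1%g = - f x.
Proof.
move=> Nx; apply: (@addrI _ (f x)); rewrite -fM //; last exact: subgV.
by rewrite mulgV hom_on1 addrN.
Qed.

Lemma hom_on_gpow x k : N x -> f (gpow x k) = f x *~ k.
Proof.
move=> Nx; have Nxk l := subg_gpow sgN l Nx.
have H (m : nat) : f (gpow x m) = f x *+ m.
  elim: m => [|m IH]; first by rewrite hom_on1 mulr0n.
  by rewrite -addn1 PoszD gpowS fM // IH addn1 mulrSr.
case: k => m; first by rewrite H pmulrn.
by rewrite NegzE gpowN hom_onV // H mulrNz pmulrn.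
Qed.

Lemma subgroup_ker : subgroup (N `&` [set x | f x = 0]).
Proof.
split; first by split; [exact: subg1 | exact: hom_on1].
split=> [x y [Nx fx] [Ny fy]|x [Nx fx]]; split => /=.
- exact: subgM.
- by rewrite gmulE fM // fx fy addr0.
- exact: subgV.
- by rewrite ginvE hom_onV // fx oppr0.
Qed.
End HomOn.

Lemma hom_on_sub (G : group) (V : zmodType) (N M : set G) (f : G -> V) :
  M `<=` N -> hom_on N f -> hom_on M f.
Proof. by move=> MN fM x y /MN Nx /MN Ny; exact: fM. Qed.

(* The exponent map of an infinite cyclic quotient. *)
Lemma infinite_cyclic_hom (G : group) (K H : set G) :
  subgroup K -> subgroup H -> H `<=` K -> normal_in H K ->
  infinite_cyclic_quotient K H ->
  exists2 f : G -> int, hom_on K f & forall x, K x -> (f x = 0 <-> H x).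
Proof.
move=> sK sH HK nHK [t Kt [ex inj]].
have /choice [f fP] : forall x, exists k, K x -> H ((gpow t k)^-1 * x)%g.
  move=> x; have [Kx|nKx] := pselect (K x); last by exists 0.
  by have [k Hk] := ex _ Kx; exists k.
have uniq x k l : H ((gpow t k)^-1 * x)%g -> H ((gpow t l)^-1 * x)%g -> k = l.
  move=> Hk Hl; apply/eqP; rewrite eq_sym -subr_eq0; apply/eqP/inj.
  have := subgM sH Hk (subgV sH Hl).
  by rewrite invgM invgK mulgA mulgK -gpowN -gpowD addrC.
exists f => [x y Kx Ky|x Kx].
  apply: (uniq (x * y)%g); first exact: fP (subgM sK Kx Ky).
  have := fP _ Kx => /(nHK _ _ (subgV sK (subg_gpow sK (f y) Kt))).
  move=> h; have := subgM sH h (fP _ Ky); rewrite !gmulE !ginvE invgK.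
  by rewrite gpowD invgM !mulgA mulgK.
split=> [f0|Hx]; first by have := fP _ Kx; rewrite f0 /= invg1 mul1g.
by apply: (uniq x) (fP _ Kx) _; rewrite /= invg1 mul1g.
Qed.

(* A section of a surjection onto Z^k along which homomorphisms can be evaluated. *)
Lemma free_quotient_lift (G : group) (N : set G) k (lam : G -> 'rV[int]_k)
    (e : 'I_k -> G) (x : G) : subgroup N -> hom_on N lam ->
  (forall j, N (e j) /\ lam (e j) = delta_mx 0 j) ->
  exists w, [/\ N w, lam w = lam x &
    forall (V : zmodType) (mu : G -> V), hom_on N mu ->
      mu w = \sum_j mu (e j) *~ lam x 0 j].
Proof.
move=> sN lamM eP.
pose w s := foldr (fun j g => gpow (e j) (lam x 0 j) * g)%g 1%g s.
have NE j l : N (gpow (e j) l) by apply: subg_gpow => //; case: (eP j).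
have Nw s : N (w s) by elim: s => [|j s IHs]; [exact: subg1|exact: subgM].
have muw s (V : zmodType) (mu : G -> V) : hom_on N mu ->
    mu (w s) = \sum_(j <- s) mu (e j) *~ lam x 0 j.
  move=> muM; elim: s => [|j s IHs]; first by rewrite big_nil (hom_on1 sN muM).
  by rewrite big_cons /= muM // IHs (hom_on_gpow sN muM) //; case: (eP j).
exists (w (index_enum 'I_k)); split=> // [|V mu]; last exact: muw.
rewrite muw // [RHS]row_sum_delta; apply: eq_bigr => j _.
by have [_ ->] := eP j; rewrite -scaler_int intz.
Qed.

(** * Hirsch rank of subgroups and the normal tower with free abelian quotients *)

Section HirschRank.
Variables (G : group) (n : nat) (S : nat -> set G) (hS : sp_series n S).

(** For a subgroup [N], the factors of the series induced on [N] embed in those of [S], so each is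
    trivial or infinite cyclic. A jump marks an infinite cyclic one, and [hrank N] is the Hirsch
    length of [N] read off along [S]. *)
Definition jumps (N : set G) (i : nat) := exists x, [/\ N x, S i.+1 x & ~ S i x].
Definition hrank (N : set G) : nat := \sum_(i < n) `[< jumps N i >].

Let sgS i : (i <= n)%N -> subgroup (S i).
Proof. by case: hS => _ [_ [h _]]; exact: h. Qed.

Let S_le i j : (i <= j <= n)%N -> S i `<=` S j.
Proof.
case: hS => _ [_ [_ h]] /andP[]; elim: j => [|j IH].
  by rewrite leqn0 => /eqP -> _ x.
rewrite leq_eqVlt => /orP[/eqP -> _ x //|ij jn] x Sx.
by have [+ _] := h _ jn; apply; exact: IH (ltnW jn) _ Sx.
Qed.

Let deg i : (i < n)%N -> exists2 f : G -> int,
  hom_on (S i.+1) f & forall x, S i.+1 x -> (f x = 0 <-> S i x).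
Proof.
move=> i_n; case: (hS) => _ [_ [_ /(_ _ i_n)[sub [nm cyc]]]].
by apply: infinite_cyclic_hom cyc; [exact: sgS|exact: sgS (ltnW i_n)| |].
Qed.

Lemma hrank_setT : hrank setT = n.
Proof.
rewrite /hrank -[RHS]card_ord -sum1_card; apply: eq_bigr => i _.
suff /asboolP -> : jumps setT i by [].
case: (hS) => _ [_ [_ /(_ _ (ltn_ord i))[_ [_ [t Kt [_ inj]]]]]].
exists t; split=> // St; have /inj : S i (gpow t 1) by rewrite /= gmul1_r.
by [].
Qed.

Lemma hrank_set1 : hrank [set 1%g] = 0%N.
Proof.
rewrite /hrank big1 // => i _; suff /asboolPn/negbTE -> : ~ jumps [set 1%g] i by [].
by case=> x [-> _]; apply; apply: subg1; exact: sgS (ltnW (ltn_ord i)).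
Qed.

(** Take the lowest level [S i.+1] containing some [y] in [N] with [mu y] nonzero. Below it [N] and
    the kernel coincide; the jump at [i] itself is lost; above it, a jump element [x] of [N] is
    corrected to [x^(mu y) y^(- mu x)], which lies in the kernel and still jumps. *)
Lemma hrank_ker (N : set G) (mu : G -> int) :
  subgroup N -> hom_on N mu -> (exists2 x, N x & mu x <> 0) ->
  hrank N = (hrank (N `&` [set x | mu x = 0])).+1.
Proof.
move=> sN muM [x0 Nx0 mux0]; set N' := N `&` _.
pose P i := `[< exists x, [/\ N x, S i x & mu x <> 0] >].
have exP : exists i, P i && (i <= n)%N.
  exists n; rewrite leqnn andbT; apply/asboolP; exists x0; split=> //.
  by case: hS => _ [-> _].
have [i /andP[/asboolP [y [Ny Siy muy]] i_n] imin] := ex_minnP exP.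
case: i => [|i] in Siy i_n imin.
  move: Siy muy; case: hS => -> _ /= ->.
  by rewrite (hom_on1 sN muM).
have mu0 x : N x -> S i x -> mu x = 0.
  move=> Nx Six; apply: contrapT => mux.
  have Pi : P i by apply/asboolP; exists x.
  by have := imin i; rewrite Pi (ltnW i_n) ltnn => /(_ isT).
have pow (a b : int) x z : N x -> N z -> N (gpow x a * gpow z b)%g.
  by move=> Nx Nz; apply: subgM => //; exact: subg_gpow.
rewrite /hrank (bigD1 (Ordinal i_n)) //= [in RHS](bigD1 (Ordinal i_n)) //=.
have /asboolP -> : jumps N i.
  by exists y; split => // Sy; apply: muy; exact: mu0.
have /asboolPn/negbTE -> : ~ jumps N' i.
  (* If [x] in the kernel jumped at [i], then [x^(f y) y^(- f x)] would have degree zero, hence lie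
     in [S i], where [mu] vanishes; but its [mu]-value is [- f x * mu y], which is nonzero. *)
  move=> [x [[Nx mux] Sx nSx]]; have [f fM f0] := deg i_n.
  have fx : f x != 0 by apply/eqP => /f0 - /(_ Sx).
  have nSy : ~ S i y by move=> /mu0 - /(_ Ny).
  have sS := sgS i_n.
  have Sz : S i (gpow x (f y) * gpow y (- f x))%g.
    apply/f0; first by apply: subgM => //; exact: subg_gpow.
    rewrite fM ?(hom_on_gpow sS fM) //; try exact: subg_gpow.
    by rewrite mulrzz mulrzz mulrN mulrC addrN.
  have := mu0 _ (pow _ _ _ _ Nx Ny) Sz.
  rewrite muM ?(hom_on_gpow sN muM) //; try exact: subg_gpow.
  rewrite mux mul0rz add0r mulrzz => /eqP.
  by rewrite mulf_eq0 oppr_eq0 (negbTE fx) orbF => /eqP.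
rewrite add1n add0n; congr _.+1; apply: eq_bigr => j ji.
have jn := ltn_ord j.
suff E : jumps N j <-> jumps N' j by rewrite (propext E).
split; last by case=> x [[Nx _] ? ?]; exists x.
move=> [x [Nx Sx nSx]].
have [lji|lij|eij] := ltngtP (j : nat) i.
- by exists x; split=> //; split=> //; apply: mu0 => //; apply: S_le Sx; rewrite lji (ltnW i_n).
- have [f fM f0] := deg jn; have sS := sgS jn.
  have Sjy : S j y by apply: S_le Siy; rewrite lij (ltnW jn).
  have Sj1y : S j.+1 y by apply: S_le Sjy; rewrite leqnSn.
  exists (gpow x (mu y) * gpow y (- mu x))%g; split.
  + split; first exact: pow.
    rewrite /= muM ?(hom_on_gpow sN muM) //; try exact: subg_gpow.
    by rewrite !mulrzz mulrN mulrC addrN.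
  + by apply: subgM => //; exact: subg_gpow.
  + move=> /f0; rewrite fM ?(hom_on_gpow sS fM) //; try exact: subg_gpow.
    have /f0 -> // := Sjy; rewrite mul0rz addr0 mulrzz => h.
    have /eqP : f x * mu y = 0 by apply: h; apply: subgM => //; exact: subg_gpow.
    by rewrite mulf_eq0 => /orP[] /eqP // /f0 - /(_ Sx).
- by move: ji; rewrite -val_eqE /= eij eqxx.
Qed.

(* A maximal surjection onto some Z^k: any further nonzero homomorphism on its
   kernel could be divided out to enlarge it. *)
Lemma max_free_quotient (N : set G) : subgroup N ->
  exists k (lam : G -> 'rV[int]_k),
  [/\ hom_on N lam, forall v, exists2 x, N x & lam x = v,
      hrank N = (k + hrank (N `&` [set x | lam x = 0%R]))%N &
      forall mu : G -> int, hom_on N mu ->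
        forall x, N x -> lam x = 0 -> mu x = 0].
Proof.
move=> sN.
(* Start from the zero map to Z^0 and induct on the rank of the kernel, which drops by one at each
   enlargement of [lam]. *)
suff H m k (lam : G -> 'rV[int]_k) : hom_on N lam ->
    (forall v, exists2 x, N x & lam x = v) ->
    hrank N = (k + hrank (N `&` [set x | lam x = 0%R]))%N ->
    (hrank (N `&` [set x | lam x = 0%R]) <= m)%N ->
    exists k (lam : G -> 'rV[int]_k),
    [/\ hom_on N lam, forall v, exists2 x, N x & lam x = v,
      hrank N = (k + hrank (N `&` [set x | lam x = 0%R]))%N &
      forall mu : G -> int, hom_on N mu ->
        forall x, N x -> lam x = 0 -> mu x = 0].
  apply: (H _ 0%N (fun=> 0)) => //.
  - by move=> x y _ _; rewrite addr0.
  - by move=> v; exists 1%g; [exact: subg1|apply/rowP => -[]].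
  rewrite add0n; congr hrank; apply/seteqP; split=> x //= [] //.
elim: m k lam => [|m IH] k lam lamM lam_surj rk rk_le.
all: have [max|/existsNP[mu /not_implyP[muM /existsNP[x0 /not_implyP[Nx0
  /not_implyP[lx0 mx0]]]]]] := pselect (forall mu : G -> int, hom_on N mu ->
        forall x, N x -> lam x = 0 -> mu x = 0).
1,3: by exists k, lam.
all: have sN' := subgroup_ker sN lamM; set N' := N `&` _ in rk rk_le sN'.
all: have muM' : hom_on N' mu by apply: hom_on_sub muM; move=> ? [].
all: have rk' := hrank_ker sN' muM' (ex_intro2 _ _ x0 (conj Nx0 lx0) mx0).
  by rewrite rk' in rk_le.
(* By Euclidean division, an element with smallest nonzero [mu]-value generates the image of [mu] on
   the kernel [N']. *)
have [z [N'z muz0] zmin] : exists2 z, N' z /\ mu z <> 0 &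
    forall x, N' x -> mu x <> 0 -> (`|mu z| <= `|mu x|)%N.
  pose P d := `[< exists x, [/\ N' x, mu x <> 0 & `|mu x|%N = d] >].
  have exP : exists d, P d by exists `|mu x0|%N; apply/asboolP; exists x0.
  have [d /asboolP[z [N'z muz <-]] zmin] := ex_minnP exP.
  by exists z => // x N'x mux; apply: zmin; apply/asboolP; exists x.
have muN' x : N' x -> (mu z %| mu x)%Z.
  move=> N'x; pose q := (mu x %/ mu z)%Z.
  have Nz : N' (gpow z (- q)) by exact: subg_gpow.
  have e : mu (x * gpow z (- q))%g = (mu x %% mu z)%Z.
    by rewrite muM' // (hom_on_gpow sN' muM') // mulrzz /modz mulrN mulrC.
  apply/dvdz_mod0P; apply: contrapT => r0.
  have := zmin _ (subgM sN' N'x Nz); rewrite e => /(_ r0).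
  have /eqP zn0 := muz0; have := modz_ge0 (mu x) zn0; have := ltz_mod (mu x) zn0.
  lia.
have /choice[e eP] : forall j : 'I_k, exists x, N x /\ lam x = delta_mx 0 j.
  by move=> j; have [x] := lam_surj (delta_mx 0 j); exists x.
(* [c x] is the value of [mu] on a lift of [lam x] built from the [e j]. Thus [mu x - c x] is a
   [mu]-value on [N'], divisible by [mu z], and the quotient [mu'] takes the value 1 at [z]; this
   keeps the pair of [lam] and [mu'] surjective. *)
pose c x : int := \sum_j lam x 0 j * mu (e j).
pose mu' x : int := ((mu x - c x) %/ mu z)%Z.
have dvd x : N x -> (mu z %| mu x - c x)%Z.
  move=> Nx.
  have [w [Nw lw muw]] := free_quotient_lift x sN lamM eP.
  have Nwi := subgV sN Nw.
  have W : N' (x * w^-1)%g.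
    split; first exact: subgM.
    by rewrite /= lamM // (hom_onV sN lamM) // lw addrN.
  have := muN' _ W; rewrite muM // (hom_onV sN muM) // muw //.
  by rewrite /c; under eq_bigr do rewrite mulrzz mulrC.
have mu'E x : N x -> mu x = c x + mu' x * mu z.
  by move=> Nx; rewrite /mu' divzK ?dvd // addrC subrK.
have cM x y : N x -> N y -> c (x * y)%g = c x + c y.
  move=> Nx Ny; rewrite /c -big_split; apply: eq_bigr => j _.
  by rewrite lamM // mxE mulrDl.
have /eqP zn0 := muz0.
have mu'M : hom_on N mu'.
  move=> x y Nx Ny; apply: (mulIf zn0); rewrite mulrDl.
  have Nxy := subgM sN Nx Ny.
  apply: (@addrI _ (c (x * y)%g)); rewrite -mu'E // muM // mu'E // (mu'E y) // cM //.
  by rewrite addrACA.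
have cN' x : lam x = 0 -> c x = 0.
  by move=> lx; rewrite /c big1 // => j _; rewrite lx mxE mul0r.
have mu'z : mu' z = 1.
  by case: N'z => Nz /cN' cz; rewrite /mu' cz subr0 divzz zn0.
pose lam' x : 'rV[int]_(k + 1) := row_mx (lam x) (mu' x)%:M.
have lam'M : hom_on N lam'.
  move=> x y Nx Ny; rewrite /lam' lamM // mu'M //.
  by rewrite add_row_mx raddfD.
have kerE : N `&` [set x | lam' x = 0] = N' `&` [set x | mu' x = 0].
  apply/seteqP; split=> [x [Nx /= /eqP]|x [[Nx lx] mx]].
    rewrite /lam' row_mx_eq0 => /andP[/eqP lx /eqP /matrixP /(_ 0 0)].
    by rewrite !mxE eqxx mulr1n => mx; split.
  by split => //=; rewrite /lam' lx mx raddf0 row_mx0.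
have rkE : hrank N' = (hrank (N `&` [set x | lam' x = 0])).+1.
  rewrite kerE; apply: hrank_ker => //; last by exists z; rewrite ?mu'z.
  by apply: hom_on_sub mu'M; move=> ? [].
apply: (IH (k + 1)%N lam') => //.
- move=> v; have [x Nx lx] := lam_surj (lsubmx v).
  have [Nz lz] := N'z.
  have NzE l : N (gpow z l) by exact: subg_gpow.
  exists (x * gpow z (rsubmx v 0 0 - mu' x))%g; first exact: subgM.
  rewrite /lam' lamM // mu'M // !(hom_on_gpow sN) // lx lz mu'z mul0rz addr0.
  rewrite mulrzz mul1r addrC subrK -[RHS]hsubmxK; congr row_mx.
  by apply/matrixP=> a b; rewrite !ord1 !mxE eqxx.
- by rewrite rk rkE -addnA add1n.
- by move: rk_le; rewrite rkE.
Qed.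

(** Starting from [G], replace a normal subgroup by the common kernel of its homomorphisms to the
    integers. The rank strictly drops until the subgroup is trivial, while the dimension reached
    plus the remaining rank stays equal to [n]. *)
Lemma normal_tower_ind (P : set G -> nat -> Prop) :
  P setT 0%N ->
  (forall (N : set G) k d (lam : G -> 'rV[int]_k),
     subgroup N -> normal_in N setT -> hom_on N lam ->
     (forall v, exists2 x, N x & lam x = v) ->
     normal_in (N `&` [set x | lam x = 0]) setT ->
     P N d -> P (N `&` [set x | lam x = 0]) (k + d)%N) ->
  P [set 1%g] n.
Proof.
move=> P0 PS.
have sT : subgroup [set: G] by [].
(* When every homomorphism from [N] to the integers vanishes, the degree map of each factor pushes
   [N] one level down the series, until it reaches [S 0]. *)
have trivial N k (lam : G -> 'rV[int]_k) : k = 0%N -> subgroup N ->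
    (forall mu : G -> int, hom_on N mu ->
        forall x, N x -> lam x = 0 -> mu x = 0) -> N = [set 1%g].
  move=> k0 sN max; subst k.
  have N1 i : (i <= n)%N -> N `<=` S (n - i).
    elim: i => [_|i IHi i_n]; first by rewrite subn0; case: hS => _ [-> _].
    have e : (n - i = (n - i.+1).+1)%N by lia.
    have lt : (n - i.+1 < n)%N by lia.
    have [f fM f0] := deg lt; have NS := IHi (ltnW i_n); rewrite e in NS.
    move=> x Nx; apply/f0; first exact: NS.
    apply: (max f) => //; first exact: hom_on_sub fM.
    by apply/rowP => -[].
  apply/seteqP; split => x; last by move=> ->; exact: subg1.
  by have := N1 _ (leqnn n) x; rewrite subnn; case: hS => -> _; apply.
suff H m N d : (hrank N <= m)%N -> subgroup N -> normal_in N setT ->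
    P N d -> P [set 1%g] (d + hrank N)%N.
  by have := H n setT 0%N; rewrite hrank_setT add0n; apply.
elim/ltn_ind: m N d => m IH N d rk_le sN nN PN.
have [k [lam [lamM lam_surj rk max]]] := max_free_quotient sN.
have [k0|k_gt0] := posnP k.
  move: PN; rewrite (trivial _ _ _ k0 sN max) => PN.
  by rewrite hrank_set1 addn0.
set N' := N `&` _ in rk.
have nN' : normal_in N' setT.
  move=> g x _ [Nx lx]; split=> /=; first exact: nN.
  apply/rowP=> j; rewrite mxE.
  (* A coordinate of [lam] precomposed with conjugation is again a homomorphism from [N] to the
     integers, so maximality makes it vanish on the kernel: the kernel is normal in all of [G]. *)
  pose mu y := lam (g * y * g^-1)%g 0 j.
  apply: (max mu) => // y z Ny Nz; rewrite /mu.
  have -> : (g * (y * z) * g^-1 = (g * y * g^-1) * (g * z * g^-1))%g.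
    by rewrite !mulgA mulgVK.
  by rewrite lamM ?mxE //; exact: nN.
rewrite rk addnA [(d + k)%N]addnC; apply: (IH (hrank N')) => //.
- by lia.
- exact: subgroup_ker.
- exact: PS.
Qed.
End HirschRank.

(** * Row vectors *)

Lemma continuous_near_eq (T U : topologicalType) (f g : T -> U) t :
  (\forall x \near t, f x = g x) -> {for t, continuous f} -> {for t, continuous g}.
Proof.
move=> fg cf A; rewrite -(nbhs_singleton fg) => /cf fA.
by apply: filterS2 fg fA => x /= ->.
Qed.

Section RowVectors.
Variable K : realType.

Lemma row_norm_leP n (v : 'rV[K]_n) (r : K) :
  0 <= r -> (`|v| <= r <-> forall i, `|v 0 i| <= r).
Proof.
move=> r0; rewrite [ `|v| ]/Num.norm /= mx_normrE; split=> [/bigmax_leP[_ h] i|h].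
  exact: (h (0, i)).
by apply/bigmax_leP; split=> // -[i j] _ /=; rewrite ord1.
Qed.

Lemma row_norm_coord n (v : 'rV[K]_n) i : `|v 0 i| <= `|v|.
Proof. by apply: (row_norm_leP v (normr_ge0 v)).1. Qed.

Lemma row_norm_ltP n (v : 'rV[K]_n) (r : K) :
  0 < r -> (`|v| < r <-> forall i, `|v 0 i| < r).
Proof.
move=> r0; rewrite [ `|v| ]/Num.norm /= mx_normrE; split=> [/bigmax_ltP[_ h] i|h].
  exact: (h (0, i)).
by apply/bigmax_ltP; split=> // -[i j] _ /=; rewrite ord1.
Qed.

Lemma cvg_row T (F : set_system T) (FF : Filter F) n (f : T -> 'rV[K]_n) (v : 'rV[K]_n) :
  (forall i, f t 0 i @[t --> F] --> v 0 i) -> f @ F --> v.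
Proof.
move=> h; apply/cvgrPdist_lt => e e0.
have : \forall t \near F, forall i : 'I_n, `|v 0 i - f t 0 i| < e.
  by apply: filter_forall => i; move/cvgrPdist_lt: (h i); apply.
by apply: filterS => t ht; apply/row_norm_ltP => // i; rewrite !mxE.
Qed.

Lemma continuous_row (T : topologicalType) n (f : T -> 'rV[K]_n) :
  (forall i, continuous (fun t => f t 0 i)) -> continuous f.
Proof. by move=> h t; apply: cvg_row => i; exact: h. Qed.

Lemma cball_compact n (r : K) : compact [set v : 'rV[K]_n | `|v| <= r].
Proof.
apply: bounded_closed_compact.
  exists r; split => [|x rx v]; first exact: num_real.
  by move=> /= /le_trans; apply; exact: ltW.
by apply: (closed_comp _ (@closed_le K r)) => v _; exact: norm_continuous.
Qed.

Lemma compact_norm_bounded (T : topologicalType) n (C : set T)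
    (f : T -> 'rV[K]_n) : compact C -> {within C, continuous f} ->
  exists2 M : K, 0 <= M & forall x, C x -> `|f x| <= M.
Proof.
move=> cC cf.
have /compact_bounded [M [Mr HM]] : compact (f @` C).
  exact: continuous_compact.
exists (`|M| + 1) => [|x Cx]; first by rewrite addr_ge0.
by apply: HM; [rewrite ltr_pwDr // ler_norm | exists x].
Qed.

Lemma continuous_sum_for (T : topologicalType) (V : normedModType K) I (r : seq I)
    (F : I -> T -> V) t :
  (forall i, {for t, continuous (F i)}) ->
  {for t, continuous (fun x => \sum_(i <- r) F i x)}.
Proof.
move=> cF; have -> : (fun x => \sum_(i <- r) F i x) = \sum_(i <- r) F i.
  by apply/funext => x; rewrite fct_sumE.
elim: r => [|i r IH]; first by rewrite big_nil; exact: cst_continuous.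
by rewrite big_cons; apply: continuousD.
Qed.

Lemma row_mx_norm_le m n (x : 'rV[K]_m) (w : 'rV[K]_n) (r : K) :
  `|row_mx x w| <= r <-> `|x| <= r /\ `|w| <= r.
Proof.
have [r0|r0] := leP 0 r; last first.
  have nle l (v : 'rV[K]_l) : ~ (`|v| <= r).
    by move/(le_trans (normr_ge0 v)); rewrite leNgt r0.
  by split=> [/nle|[/nle]].
rewrite !row_norm_leP //; split=> [h|[hx hw] i].
  split=> i; first by have := h (lshift n i); rewrite row_mxEl.
  by have := h (rshift m i); rewrite row_mxEr.
by case: (splitP i) => j ij; rewrite !mxE; case: split_ordP => l _.
Qed.

Lemma norm_lsubmx m n (u : 'rV[K]_(m + n)) : `|lsubmx u| <= `|u|.
Proof. by have [] := (row_mx_norm_le (lsubmx u) (rsubmx u) `|u|).1; rewrite ?hsubmxK. Qed.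

Lemma norm_rsubmx m n (u : 'rV[K]_(m + n)) : `|rsubmx u| <= `|u|.
Proof. by have [] := (row_mx_norm_le (lsubmx u) (rsubmx u) `|u|).1; rewrite ?hsubmxK. Qed.

Lemma lsubmx_continuous m n : continuous (@lsubmx K 1 m n).
Proof.
apply: continuous_row => i.
have -> : (fun u : 'rV[K]_(m + n) => lsubmx u 0 i) = fun u => u 0 (lshift n i).
  by apply/funext => u; rewrite mxE.
exact: coord_continuous.
Qed.

Lemma rsubmx_continuous m n : continuous (@rsubmx K 1 m n).
Proof.
apply: continuous_row => i.
have -> : (fun u : 'rV[K]_(m + n) => rsubmx u 0 i) = fun u => u 0 (rshift m i).
  by apply/funext => u; rewrite mxE.
exact: coord_continuous.
Qed.

Lemma continuous_row_mx (T : topologicalType) m n (f : T -> 'rV[K]_m) (g : T -> 'rV[K]_n) :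
  continuous f -> continuous g -> continuous (fun t => row_mx (f t) (g t)).
Proof.
move=> cf cg; apply: continuous_row => i.
case: (split_ordP i) => j ->.
  have -> : (fun t => row_mx (f t) (g t) 0 (lshift n j)) = fun t => f t 0 j.
    by apply/funext => t; rewrite row_mxEl.
  move=> t; apply: (@continuous_comp _ _ _ f (fun x : 'rV[K]_m => x 0 j)); first exact: cf.
  exact: coord_continuous.
have -> : (fun t => row_mx (f t) (g t) 0 (rshift m j)) = fun t => g t 0 j.
  by apply/funext => t; rewrite row_mxEr.
move=> t; apply: (@continuous_comp _ _ _ g (fun x : 'rV[K]_n => x 0 j)); first exact: cg.
exact: coord_continuous.
Qed.

Lemma mulmxr_continuous m n (A : 'M[K]_(m, n)) : continuous (fun u : 'rV[K]_m => u *m A).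
Proof.
apply: continuous_row => i.
have -> : (fun u : 'rV[K]_m => (u *m A) 0 i) =
    fun u => \sum_(j <- index_enum 'I_m) u 0 j * A j i.
  by apply/funext => u; rewrite mxE.
move=> u; apply: (@continuous_sum_for _ K) => j.
apply: (@continuousM K _ (fun u : 'rV[K]_m => u 0 j) (cst (A j i))).
  exact: coord_continuous.
exact: cst_continuous.
Qed.

Lemma map_mx_continuous n (f : K -> K) : continuous f ->
  continuous (fun u : 'rV[K]_n => map_mx f u).
Proof.
move=> cf; apply: continuous_row => i.
have -> : (fun u : 'rV[K]_n => map_mx f u 0 i) = fun u => f (u 0 i).
  by apply/funext => u; rewrite mxE.
move=> u; apply: (@continuous_comp _ K K (fun u : 'rV[K]_n => u 0 i) f); last exact: cf.
exact: coord_continuous.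
Qed.

Lemma uniform_norm_bound (I : eqType) (s : seq I) m n (F : I -> 'rV[K]_m -> 'rV[K]_n) r :
  (forall i, continuous (F i)) ->
  exists2 M : K, 0 <= M & forall i z, i \in s -> `|z| <= r -> `|F i z| <= M.
Proof.
move=> cF; elim: s => [|i s [M M0 HM]]; first by exists 0.
have [M' M'0 HM'] := compact_norm_bounded (@cball_compact m r)
  (continuous_subspaceT (cF i)).
exists (M + M') => [|j z]; first exact: addr_ge0.
rewrite inE => /orP[/eqP ->|js] zr.
  by rewrite (le_trans (HM' _ zr)) // lerDr.
by rewrite (le_trans (HM _ _ js zr)) // lerDl.
Qed.

(** Discreteness of the integer lattice; it gives properness in the fibre direction. *)
Lemma int_row_bounded n (r : K) : exists s : seq 'rV[int]_n,
  forall v, `|map_mx intr v : 'rV[K]_n| <= r -> v \in s.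
Proof.
pose B := Num.Def.archi_bound r.
exists [seq map_mx (fun i : 'I_(B + B).+1 => i%:Z - B%:Z) M | M <- enum 'rV['I_(B + B).+1]_n].
move=> v vr; apply/mapP.
exists (map_mx (fun z : int => inord (absz (z + B%:Z)%R)) v); first by rewrite mem_enum.
apply/rowP => i; rewrite !mxE.
have := le_trans (row_norm_coord _ i) vr; rewrite mxE -intr_norm => h.
have : `|v 0 i| < B%:Z.
  rewrite -(ltr_int K); apply: le_lt_trans h _; apply: archi_boundP.
  exact: le_trans (normr_ge0 _) vr.
move=> {h}; rewrite ltr_norml => /andP[h1 h2]; move: (v 0 i) h1 h2 => z h1 h2.
by rewrite inordK; lia.
Qed.
End RowVectors.

(** * A slow homeomorphism of the line *)

Section SlowHomeo.
Variables (K : realType) (D : nat -> K).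

(** A nondecreasing majorant of [D], kept at least 1 so that it can serve as a denominator. *)
Let L (j : nat) : K := 1 + \sum_(i < j.+1) `|D i|.

Let L_ge1 j : 1 <= L j.
Proof. by rewrite lerDl sumr_ge0. Qed.

Let L_gt0 j : 0 < L j.
Proof. exact: lt_le_trans (L_ge1 j). Qed.

Let D_le j : D j <= L j.
Proof.
apply: le_trans (ler_norm _) _; rewrite /L big_ord_recr /= addrA lerDr.
by rewrite addr_ge0 // sumr_ge0.
Qed.

Let L_homo i j : (i <= j)%N -> L i <= L j.
Proof.
move=> /subnK <-; elim: (j - i)%N => [|m IH]; first by rewrite add0n.
apply: le_trans IH _; rewrite addSn /L [X in _ <= 1 + X]big_ord_recr /= addrA.
by rewrite lerDl.
Qed.

(** An infimum of lines with growing intercepts and shrinking slopes. The line of index [j] forces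
    [s0 (L j)] to be at most [j + 1], however fast [D] grows. *)
Let s0 (t : K) : K := inf [set j%:R + t / L j | j in setT].

Let s0_le t j : 0 <= t -> s0 t <= j%:R + t / L j.
Proof.
move=> t0; apply: ge_inf; last by exists j.
by exists 0 => _ [i _ <-]; rewrite addr_ge0 // divr_ge0 // ltW.
Qed.

Let le_s0 t c : (forall j, c <= j%:R + t / L j) -> c <= s0 t.
Proof.
move=> h; apply: lb_le_inf; first by exists (0%:R + t / L 0), 0%N.
by move=> _ [j _ <-]; exact: h.
Qed.

Let s0_ge0 t : 0 <= t -> 0 <= s0 t.
Proof. by move=> t0; apply: le_s0 => j; rewrite addr_ge0 // divr_ge0 // ltW. Qed.

Let s0_le_id t : 0 <= t -> s0 t <= t.
Proof.
move=> t0; apply: le_trans (s0_le 0 t0) _; rewrite add0r ler_pdivrMr //.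
by rewrite ler_peMr.
Qed.

Let s00 : s0 0 = 0.
Proof. by apply/le_anti; rewrite s0_le_id // s0_ge0. Qed.

(** Given line [i] for [s] and line [j] for [t], use the line of larger index at [s + t]: its slope
    is at most both slopes and its intercept is one of the two. *)
Let s0D s t : 0 <= s -> 0 <= t -> s0 (s + t) <= s0 s + s0 t.
Proof.
move=> s_ge0 t_ge0; rewrite -lerBlDr; apply: le_s0 => i.
rewrite lerBlDr [leRHS]addrC -lerBlDr; apply: le_s0 => j; rewrite lerBlDr.
have st := addr_ge0 s_ge0 t_ge0.
have le_div m l u : 0 <= u -> (m <= l)%N -> u / L l <= u / L m.
  by move=> u0 ml; rewrite ler_wpM2l // lef_pV2 ?posrE // L_homo.
have i0 : 0 <= i%:R :> K by []. have j0 : 0 <= j%:R :> K by [].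
have [ij|/ltnW ji] := leqP i j.
  apply: le_trans (s0_le j st) _; rewrite mulrDl.
  have := le_div _ _ _ s_ge0 ij; lra.
apply: le_trans (s0_le i st) _; rewrite mulrDl.
have := le_div _ _ _ t_ge0 ji; lra.
Qed.

Let s0_lt s t : 0 <= s -> s < t -> s0 s < s0 t.
Proof.
move=> s_ge0 st; have t_gt0 : 0 < t by exact: le_lt_trans st.
(* Lines of index at least [J] already lie above [t + 1]; the others have slope at least [1 / L J],
   whence the gap [e]. *)
pose J := (Num.truncn t).+2; have tJ : t + 1 <= J%:R.
  by rewrite /J -addn1 natrD lerD2r ltW // truncnS_gt.
pose e := Num.min 1 ((t - s) / L J).
have e0 : 0 < e by rewrite lt_min ltr01 divr_gt0 // subr_gt0.
apply: (@lt_le_trans _ _ (s0 s + e)); first by rewrite ltrDl.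
apply: le_s0 => j; have [jJ|Jj] := ltnP j J.
  apply: (@le_trans _ _ ((j%:R + s / L j) + (t - s) / L j)).
    apply: lerD; first exact: s0_le.
    rewrite ge_min; apply/orP; right; rewrite ler_wpM2l ?subr_ge0 ?(ltW st) //.
    by rewrite lef_pV2 ?posrE // L_homo // ltnW.
  by rewrite -addrA -mulrDl [s + _]addrC subrK.
apply: (@le_trans _ _ (t + 1)).
  by apply: lerD; [apply: le_trans (s0_le_id s_ge0) (ltW st)|rewrite ge_min lexx].
apply: le_trans tJ _; apply: (@le_trans _ _ j%:R).
  by rewrite ler_nat.
by rewrite lerDl divr_ge0 // ltW.
Qed.

Definition slow (x : K) : K := Num.sg x * s0 `|x|.

Let slow_ge0 x : 0 <= x -> slow x = s0 x.
Proof.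
rewrite /slow le_eqVlt => /orP[/eqP <-|x0]; first by rewrite sgr0 mul0r s00.
by rewrite gtr0_sg // mul1r gtr0_norm.
Qed.

Let slowN x : slow (- x) = - slow x.
Proof. by rewrite /slow sgrN normrN mulNr. Qed.

Let slow_lt : {homo slow : x y / x < y}.
Proof.
move=> x y xy; have [x0|x0] := leP 0 x.
  by rewrite !slow_ge0 ?(le_trans x0 (ltW xy)) // s0_lt.
have xE : slow x = - s0 (- x) by rewrite -[x in LHS]opprK slowN slow_ge0 // oppr_ge0 ltW.
rewrite xE; have [y0|y0] := leP 0 y.
  rewrite slow_ge0 //; apply: (@lt_le_trans _ _ 0); last exact: s0_ge0.
  by rewrite oppr_lt0 -s00 s0_lt // oppr_gt0.
by rewrite -[y]opprK slowN slow_ge0 ?oppr_ge0 ?(ltW y0) // ltrN2 s0_lt ?ltrN2 // oppr_ge0 ltW.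
Qed.

Lemma slow_le : {homo slow : x y / x <= y}.
Proof. by move=> x y; rewrite le_eqVlt => /orP[/eqP ->//|/slow_lt/ltW]. Qed.

Lemma slow_bound j : slow (D j) <= j%:R + 1.
Proof.
apply: (@le_trans _ _ (slow (L j))); first exact/slow_le/D_le.
have L0 := ltW (L_gt0 j).
by rewrite slow_ge0 //; apply: le_trans (s0_le j L0) _; rewrite divff ?gt_eqF.
Qed.

(** For arguments of the same sign this is subadditivity of [s0]. For opposite signs both absolute
    values are at most the distance, which costs the factor 2. *)
Lemma slow_dist x y : `|slow x - slow y| <= 2 * slow `|x - y|.
Proof.
wlog yx : x y / y <= x => [H|].
  by have [/H//|/ltW/H] := leP y x; rewrite distrC [ `|y - x| ]distrC.
have d0 : 0 <= x - y by rewrite subr_ge0.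
rewrite !ger0_norm ?subr_ge0 ?slow_le // (slow_ge0 d0).
have s_ge0 := s0_ge0 d0.
have pos u v : 0 <= v -> v <= u -> s0 u - s0 v <= s0 (u - v).
  move=> v0 vu; rewrite lerBlDr -{1}(subrK v u); apply: s0D => //.
  by rewrite subr_ge0.
have [y0|y0] := leP 0 y.
  rewrite !slow_ge0 ?(le_trans y0) //; have := pos _ _ y0 yx; lra.
have yE : slow y = - s0 (- y) by rewrite -[y in LHS]opprK slowN slow_ge0 // oppr_ge0 ltW.
have mono u v : 0 <= u -> u <= v -> s0 u <= s0 v.
  by move=> u0; rewrite le_eqVlt => /orP[/eqP ->//|/(s0_lt u0)/ltW].
rewrite yE; have [x0|x0] := leP 0 x.
  rewrite slow_ge0 // opprK mulr_natl mulr2n.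
  by apply: lerD; apply: mono; lra.
rewrite -[x in slow x]opprK slowN slow_ge0 ?oppr_ge0 ?(ltW x0) //.
have : s0 (- y) - s0 (- x) <= s0 (x - y).
  have -> : x - y = - y - - x by rewrite opprK addrC.
  by apply: pos; lra.
lra.
Qed.

Lemma slow_continuous : continuous slow.
Proof.
move=> x; apply/cvgrPdist_lt => e e0; near=> y.
apply: le_lt_trans (slow_dist _ _) _.
apply: (@le_lt_trans _ _ (2 * `|x - y|)).
  by rewrite ler_wpM2l // slow_ge0 // s0_le_id.
rewrite mulrC -ltr_pdivlMr //; near: y.
by apply: (@cvgr_dist_lt _ K^o) => //; rewrite divr_gt0.
Unshelve. all: by end_near. Qed.

Let slow_surj y : exists x, slow x = y.
Proof.
pose m := (Num.truncn `|y|).+1; have ym : `|y| <= m%:R.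
  by rewrite ltW // truncnS_gt.
(* At this [t] every line has height at least [m]: through its linear term when [j <= m], through
   its intercept otherwise. The intermediate value theorem on [[- t, t]] then reaches [y]. *)
pose t := m%:R * L m; have t0 : 0 <= t by rewrite mulr_ge0 // ltW.
have mt : m%:R <= s0 t.
  apply: le_s0 => j; have [jm|mj] := leqP j m.
    apply: (@le_trans _ _ (t / L j)); last by rewrite lerDr.
    by rewrite ler_pdivlMr // ler_wpM2l // L_homo.
  apply: (@le_trans _ _ j%:R); first by rewrite ler_nat ltnW.
  by rewrite lerDl divr_ge0 // ltW.
have tt : - t <= t by lra.
have [||x _ <-] := @IVT K slow (- t) t y tt; last by exists x.
  exact/continuous_subspaceT/slow_continuous.
rewrite (min_l (slow_le tt)) (max_r (slow_le tt)) slowN slow_ge0 // -ler_norml.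
exact: le_trans ym mt.
Qed.

Definition fast (y : K) : K := sval (cid (slow_surj y)).

Lemma fastK : cancel fast slow.
Proof. by move=> y; rewrite /fast; case: cid. Qed.

Let slow_mono x y : (slow x < slow y) = (x < y).
Proof.
by apply/idP/idP => [|/slow_lt//]; apply: contraTT; rewrite -!leNgt => /slow_le.
Qed.

Lemma slowK : cancel slow fast.
Proof.
move=> x; apply/eqP; rewrite eq_le !leNgt -(slow_mono x (fast (slow x))).
by rewrite -(slow_mono (fast (slow x)) x) fastK !ltxx.
Qed.

Lemma fast_continuous : continuous fast.
Proof.
move=> y; apply/cvgrPdist_lt => e e0; near=> z.
rewrite distrC ltr_distl -(slow_mono (fast y - e)) -(slow_mono (fast z)) fastK.
apply/andP; split; near: z.
  apply: (@cvgr_gt K _ _ _ id y) => //.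
  by rewrite -{2}[y]fastK slow_lt // ltrBlDr ltrDl.
apply: (@cvgr_lt K _ _ _ id y) => //.
by rewrite -{1}[y]fastK slow_lt // ltrDl.
Unshelve. all: by end_near. Qed.
End SlowHomeo.

(** * Seifert fibrations *)

Section Stage.
Variables (K : realType) (G : group).

(* An action of [G / N] on [R^d] by homeomorphisms, proper and cocompact, in which the
   translates of a bounded set that are far from the origin look small from there. *)
Definition geometric_mod (N : set G) (d : nat) (a : G -> 'rV[K]_d -> 'rV[K]_d) :=
  [/\ (forall x, a 1%g x = x) /\ (forall g h x, a (g * h)%g x = a g (a h x)),
      (forall g, continuous (a g)) /\ (forall g x, N g -> a g x = x),
      forall r : K, exists s : seq G, forall g x, `|x| <= r -> `|a g x| <= r ->
        exists2 h, h \in s & N (h^-1 * g)%g,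
      exists r : K, forall x, exists g, `|a g x| <= r &
      forall r e : K, 0 < e -> exists rho : K, forall g x y,
        `|x| <= r -> `|y| <= r -> rho <= `|a g x| ->
        `|a g x - a g y| <= e * `|a g x|].
End Stage.

(** * The set-theoretic cocycle obtained from coset representatives *)

Section SeifertCocycle.
Variables (K : realType) (G : group) (N : set G) (k : nat) (lam : G -> 'rV[int]_k).
Hypotheses (sN : subgroup N) (nN : normal_in N setT) (lamM : hom_on N lam).
Hypothesis lam_surj : forall v, exists2 x, N x & lam x = v.
Hypothesis nN' : normal_in (N `&` [set x | lam x = 0]) setT.

Let NJ g x : N x -> N (g * x * g^-1)%g.
Proof. exact: nN. Qed.

Let NJV g x : N x -> N (g^-1 * x * g)%g.
Proof. by move=> /(NJ g^-1%g); rewrite invgK. Qed.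

Definition coset_repr (g : G) : G := xget 1%g [set x | N (g^-1 * x)%g].

Lemma coset_reprP g : N (g^-1 * coset_repr g)%g.
Proof.
by apply: (@xgetPex _ 1%g [set x | N (g^-1 * x)%g]); exists g; rewrite /= mulVg; exact: subg1.
Qed.

Lemma coset_repr_eq g h : N (g^-1 * h)%g -> coset_repr g = coset_repr h.
Proof.
move=> gh; rewrite /coset_repr; congr xget; apply/seteqP; split=> x /= Nx.
  by have := subgM sN (subgV sN gh) Nx; rewrite invgM invgK mulgA mulgK.
by have := subgM sN gh Nx; rewrite mulgA mulgK.
Qed.

Lemma coset_repr_id g : coset_repr (coset_repr g) = coset_repr g.
Proof. by rewrite -(coset_repr_eq (coset_reprP g)). Qed.

Lemma coset_repr_inj g h : coset_repr g = coset_repr h -> N (g^-1 * h)%g.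
Proof.
move=> E; have := subgM sN (coset_reprP g) (subgV sN (coset_reprP h)).
by rewrite E (invgM h^-1%g) invgK mulgA mulgK.
Qed.

Definition lamK (g : G) : 'rV[K]_k := map_mx intr (lam g).

Lemma lamK_M : hom_on N lamK.
Proof. by move=> x y Nx Ny; rewrite /lamK lamM // map_mxD. Qed.

Let eP : exists e : 'I_k -> G, forall j, N (e j) /\ lam (e j) = delta_mx 0 j.
Proof.
have /choice[f fP] j : exists x, N x /\ lam x = delta_mx 0 j.
  by have [x] := lam_surj (delta_mx 0 j); exists x.
by exists f.
Qed.

Let e := sval (cid eP).

Let e_N j : N (e j). Proof. by rewrite /e; case: cid => f /= /(_ j) []. Qed.
Let lam_e j : lam (e j) = delta_mx 0 j.
Proof. by rewrite /e; case: cid => f /= /(_ j) []. Qed.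
Let lamK_e j : lamK (e j) = delta_mx 0 j.
Proof. by rewrite /lamK lam_e map_delta_mx. Qed.

(** The matrix of conjugation by [g] on the lattice [lam] maps [N] onto. It acts on rows from the
    right, so products come in reverse order. *)
Definition conj_mx (g : G) : 'M[K]_k := \matrix_j lamK (g * e j * g^-1)%g.

(** Compare [x] with a word [w] in the [e j] having the same [lam]-value: they differ by an element
    of the kernel, which stays in the kernel under conjugation. *)
Lemma lamKJ g x : N x -> lamK (g * x * g^-1)%g = lamK x *m conj_mx g.
Proof.
move=> Nx; pose mu y := lamK (g * y * g^-1)%g.
have muM : hom_on N mu.
  move=> y z Ny Nz; rewrite /mu -lamK_M; try exact: NJ.
  by rewrite !mulgA mulgVK.
have [w [Nw lw muw]] := free_quotient_lift x sN lamM (fun j => conj (e_N j) (lam_e j)).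
have Nwi := subgV sN Nw.
have : mu (x * w^-1)%g = 0.
  have [_ /= l0] : (N `&` [set x | lam x = 0]) (g * (x * w^-1) * g^-1)%g.
    apply: nN' => //; split; first exact: subgM.
    by rewrite /= lamM // (hom_onV sN lamM) // lw addrN.
  by rewrite /mu /lamK l0 map_mx0.
rewrite muM // (hom_onV sN muM) // => /eqP; rewrite subr_eq0 => /eqP.
rewrite -/(mu x) => ->; rewrite muw // mulmx_sum_row; apply: eq_bigr => j _.
by rewrite rowK !mxE scaler_int.
Qed.

Let conj_mx_eq (M1 M2 : 'M[K]_k) :
  (forall x, N x -> lamK x *m M1 = lamK x *m M2) -> M1 = M2.
Proof.
move=> h; apply/row_matrixP => j.
by rewrite !rowE -lamK_e h.
Qed.

Lemma conj_mxM g h : conj_mx (g * h)%g = conj_mx h *m conj_mx g.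
Proof.
apply: conj_mx_eq => x Nx; rewrite mulmxA -!lamKJ //; last exact: NJ.
by rewrite invgM !mulgA.
Qed.

Lemma conj_mxN n : N n -> conj_mx n = 1%:M.
Proof.
move=> Nn; apply: conj_mx_eq => x Nx; have Nni := subgV sN Nn.
rewrite -lamKJ // mulmx1 !lamK_M // ?(hom_onV sN lamK_M) //; last exact: subgM.
by rewrite addrAC addrN add0r.
Qed.

(** The lattice part of [g] when it is written as an element of [N] times its coset
    representative. *)
Definition retr (g : G) : 'rV[K]_k := lamK (g * (coset_repr g)^-1)%g.

Lemma retrM n g : N n -> retr (n * g)%g = lamK n + retr g.
Proof.
move=> Nn; rewrite /retr; have -> : coset_repr (n * g)%g = coset_repr g.
  by apply/esym/coset_repr_eq; rewrite mulgA; exact: NJV.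
have := NJ g (subgV sN (coset_reprP g)).
rewrite invgM invgK !mulgA mulgK => Nr.
by rewrite -mulgA (lamK_M Nn Nr).
Qed.

(** The failure of [retr] to be equivariant for the linear action [conj_mx], that is, a twisted
    coboundary. *)
Definition defect (g h : G) : 'rV[K]_k := retr (g * h)%g - retr h *m conj_mx g.

(** Moving [n] to the left of [h] adds the same vector to both terms of the defect. The defect is
    thus a function of the coset of [h], which is what permits averaging over [G / N]. *)
Lemma defect_coset g h n : N n -> defect g (h * n)%g = defect g h.
Proof.
move=> Nn; pose m := (h * n * h^-1)%g; have Nm : N m by exact: NJ.
have E : (h * n = m * h)%g by rewrite /m mulgVK.
have E2 : (g * (h * n) = (g * m * g^-1) * (g * h))%g by rewrite E -!mulgA mulKg.
rewrite /defect E2 E (retrM _ (NJ g Nm)) (retrM _ Nm) lamKJ //.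
by rewrite mulmxDl opprD addrACA addrN add0r.
Qed.

Lemma defectM g1 g2 h :
  defect (g1 * g2)%g h = defect g1 (g2 * h)%g + defect g2 h *m conj_mx g1.
Proof.
by rewrite /defect conj_mxM mulmxBl addrA subrK !mulgA mulmxA.
Qed.

Lemma defectN n h : N n -> defect n h = lamK n.
Proof. by move=> Nn; rewrite /defect conj_mxN // mulmx1 retrM // addrK. Qed.
End SeifertCocycle.

(** * Averaging over cosets with an equivariant partition of unity on the base *)

Section CosetAverage.
Variables (K : realType) (G : group) (N : set G) (d : nat) (a : G -> 'rV[K]_d -> 'rV[K]_d).
Hypotheses (sN : subgroup N) (geo : geometric_mod N a).

Let a1 x : a 1%g x = x. Proof. by case: geo => [[]]. Qed.
Let aM g h x : a (g * h)%g x = a g (a h x). Proof. by case: geo => [[]]. Qed.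
Let ac g : continuous (a g). Proof. by case: geo => [_ []]. Qed.
Let aN n x : N n -> a n x = x. Proof. by case: geo => [_ [_ h] _ _ _]; exact: h. Qed.
Let aK g x : a g^-1%g (a g x) = x. Proof. by rewrite -aM mulVg a1. Qed.

Let geo_cocompact : exists r : K, forall x, exists g, `|a g x| <= r.
Proof. by case: geo. Qed.

Let r0 := sval (cid geo_cocompact).

Let r0P x : exists g, `|a g x| <= r0.
Proof. exact: (svalP (cid geo_cocompact)). Qed.

Let T : set G := range (coset_repr N).

Let T_id h : T h -> coset_repr N h = h.
Proof. by move=> [x _ <-]; exact: coset_repr_id. Qed.

(** A tent function on the [h]-translate of the ball of radius [r0 + 1]. Translates of the ball of
    radius [r0] cover the base, and the extra 1 makes some tent strictly positive at each point. *)
Let bump (h : G) (w : 'rV[K]_d) : K := Num.max 0 (r0 + 1 - `|a h^-1%g w|).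

Let bump_ge0 h w : 0 <= bump h w. Proof. by rewrite le_max lexx. Qed.

Let bump_coset h n w : N n -> bump (h * n)%g w = bump h w.
Proof. by move=> Nn; rewrite /bump invgM aM aN //; exact: subgV. Qed.

Let bump_repr h w : bump (coset_repr N h) w = bump h w.
Proof. by rewrite -{1}(mulVKg h (coset_repr N h)) bump_coset //; exact: coset_reprP. Qed.

Let bumpM g h w : bump (g * h)%g (a g w) = bump h w.
Proof. by rewrite /bump invgM aM aK. Qed.

(** Properness gives local finiteness: only finitely many cosets have a tent meeting a given
    ball. *)
Let bump_supp (rho : K) : exists L : seq G, [/\ uniq L, [set` L] `<=` T &
  forall w h, `|w| <= rho -> T h -> h \notin L -> bump h w = 0].
Proof.
case: geo => _ _ /(_ (Num.max rho (r0 + 1)))[s sP] _ _.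
exists (undup [seq coset_repr N h | h <- s]); split.
- exact: undup_uniq.
- by move=> h /=; rewrite mem_undup => /mapP[x _ ->]; exists x.
- move=> w h wr Th; rewrite mem_undup => hL; apply/eqP; rewrite eq_le bump_ge0 andbT.
  rewrite ge_max lexx /= subr_le0 leNgt; apply/negP => small.
  have [||x xs Nx] := sP h (a h^-1%g w).
  + by rewrite le_max (ltW small) orbT.
  + by rewrite -aM mulgV a1 le_max wr.
  + move/negP: hL; apply; apply/mapP; exists x => //.
    by rewrite -{1}(T_id Th) (coset_repr_eq sN Nx).
Qed.

Let wsum (V : lmodType K) (F : G -> V) w : V := \sum_(h \in T) (bump h w *: F h).

Let wsumE (rho : K) : exists L : seq G, [set` L] `<=` T /\
  forall (V : lmodType K) (F : G -> V) w, `|w| <= rho ->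
    wsum F w = \sum_(h <- L) bump h w *: F h.
Proof.
have [L [uL LT supp]] := bump_supp rho; exists L; split=> // V F w wr.
rewrite /wsum (fsbigE L) //; last by move=> h Th hL; rewrite (supp w h) // scale0r.
rewrite big_seq_cond [RHS]big_seq; apply: eq_bigl => h.
by case: (boolP (h \in L)) => //= hL; apply/mem_set/LT.
Qed.

(** Left multiplication by [g] permutes the cosets and carries the tent of [h] at [w] to that of
    [g h] at [a g w]. *)
Let wsum_reindex (V : lmodType K) (F : G -> V) g w :
  (forall h n, N n -> F (h * n)%g = F h) ->
  wsum (fun h => F (g * h)%g) w = wsum F (a g w).
Proof.
move=> FN; have FR h : F (coset_repr N h) = F h.
  by rewrite -{1}(mulVKg h (coset_repr N h)) FN //; exact: coset_reprP.
have bij : set_bij T T (fun h => coset_repr N (g * h)%g).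
  split; first by move=> h _; exists (g * h)%g.
    move=> x y /set_mem Tx /set_mem Ty E.
    have := coset_repr_inj sN E; rewrite invgM -mulgA mulKg.
    by move=> /(coset_repr_eq sN); rewrite !T_id.
  move=> y Ty; exists (coset_repr N (g^-1 * y)%g); first by exists (g^-1 * y)%g.
  rewrite -[RHS](T_id Ty); apply/esym/(coset_repr_eq sN).
  by have := coset_reprP sN (g^-1 * y)%g; rewrite invgM invgK -mulgA.
rewrite /wsum [RHS](reindex_fsbig _ _ _ _ bij); apply: eq_fsbigr => h _.
by rewrite bump_repr FR bumpM.
Qed.

Let total w : K := wsum (fun=> (1 : K^o)) w.

Let total_gt0 w : 0 < total w.
Proof.
have [L [uL LT supp]] := bump_supp `|w|.
have [g gr] := r0P w; set h := coset_repr N g^-1%g.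
have b1 : 0 < bump h w.
  by rewrite bump_repr lt_max invgK; apply/orP; right; rewrite subr_gt0 ltr_pwDr.
have hL : h \in L.
  apply: contraT => hL; move: b1; rewrite (supp w h) ?ltxx //.
  by exists g^-1%g.
have -> : total w = \sum_(h <- L) bump h w.
  rewrite /total /wsum (fsbigE L) //; last first.
    by move=> i Ti iL; rewrite (supp w i) // scale0r.
  rewrite big_seq_cond [RHS]big_seq; apply: eq_big => [i|i _]; last first.
    by rewrite -[_ *: _]/(_ * _) mulr1.
  by case: (boolP (i \in L)) => //= iL; apply/mem_set/LT.
by rewrite (big_rem h hL) /= ltr_pwDl // sumr_ge0.
Qed.

Definition coset_avg (V : lmodType K) (F : G -> V) w : V := (total w)^-1 *: wsum F w.

Lemma coset_avg_cst (V : lmodType K) (v : V) w : coset_avg (fun=> v) w = v.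
Proof.
have [L [LT wE]] := wsumE `|w|.
rewrite /coset_avg wE // -scaler_suml.
have -> : \sum_(h <- L) bump h w = total w.
  by rewrite /total wE //; apply: eq_bigr => h _; rewrite -[_ *: _]/(_ * _) mulr1.
by rewrite scalerA mulVf ?scale1r // gt_eqF.
Qed.

Lemma coset_avgD (V : lmodType K) (F1 F2 : G -> V) w :
  coset_avg (fun h => F1 h + F2 h) w = coset_avg F1 w + coset_avg F2 w.
Proof.
have [L [LT wE]] := wsumE `|w|; rewrite /coset_avg !wE // -scalerDr -big_split.
by congr (_ *: _); apply: eq_bigr => h _; rewrite scalerDr.
Qed.

Lemma coset_avg_linear (V V' : lmodType K) (f : {linear V -> V'}) (F : G -> V) w :
  coset_avg (fun h => f (F h)) w = f (coset_avg F w).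
Proof.
have [L [LT wE]] := wsumE `|w|; rewrite /coset_avg !wE // [RHS]linearZ_LR /=.
by congr (_ *: _); rewrite linear_sum; apply: eq_bigr => h _; rewrite linearZ_LR.
Qed.

Lemma coset_avg_act (V : lmodType K) (F : G -> V) g w :
  (forall h n, N n -> F (h * n)%g = F h) ->
  coset_avg (fun h => F (g * h)%g) w = coset_avg F (a g w).
Proof.
move=> FN; rewrite /coset_avg wsum_reindex //; congr (_^-1 *: _).
by rewrite /total -(wsum_reindex (F := fun=> 1)).
Qed.

Lemma coset_avg_continuous (V : normedModType K) (F : G -> V) :
  continuous (coset_avg F).
Proof.
move=> w; have [L [LT wE]] := wsumE (`|w| + 1).
have near_w : \forall x \near w, `|x| <= `|w| + 1.
  have : \forall x \near w, `|w - x| < 1 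
    by have := nbhsx_ballx w 1 ltr01; rewrite -ball_normE.
  apply: filterS => x wx; have := ler_normD (x - w) w; rewrite subrK distrC.
  by move=> /le_trans; apply; rewrite addrC lerD2l ltW.
have bump_cont h : {for w, continuous (bump h)}.
  apply: (@continuous_max K _ (cst 0)); first exact: cst_continuous.
  apply: (@continuousB K K _ (cst (r0 + 1)) (fun w => `|a h^-1%g w|)).
    exact: cst_continuous.
  by apply: continuous_comp; [exact: ac|exact: norm_continuous].
have wsum_cont (W : normedModType K) (F' : G -> W) : {for w, continuous (wsum F')}.
  apply: (@continuous_near_eq _ _ (fun x => \sum_(h <- L) bump h x *: F' h)).
    by apply: filterS near_w => x xr; rewrite wE.
  apply: (@continuous_sum_for K _ W G L (fun h x => bump h x *: F' h) w) => h.
  by apply: continuousZr_tmp; exact: bump_cont.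
apply: (@continuousZ K V _ (fun w => (total w)^-1) (wsum F) w); last exact: wsum_cont.
apply: (@continuousV K _ total w); first by rewrite gt_eqF.
exact: (wsum_cont K^o).
Qed.
End CosetAverage.

(** * The Seifert action on the product of fibre and base *)

Section SeifertAction.
Variables (K : realType) (G : group) (N : set G) (k d : nat).
Variables (lam : G -> 'rV[int]_k) (a : G -> 'rV[K]_d -> 'rV[K]_d).
Hypotheses (sN : subgroup N) (nN : normal_in N setT) (lamM : hom_on N lam).
Hypothesis lam_surj : forall v, exists2 x, N x & lam x = v.
Hypothesis nN' : normal_in (N `&` [set x | lam x = 0]) setT.
Hypothesis geo : geometric_mod N a.

Let a1 x : a 1%g x = x. Proof. by case: geo => [[]]. Qed.
Let aM g h x : a (g * h)%g x = a g (a h x). Proof. by case: geo => [[]]. Qed.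
Let ac g : continuous (a g). Proof. by case: geo => [_ []]. Qed.
Let aN n x : N n -> a n x = x. Proof. by case: geo => [_ [_ h] _ _ _]; exact: h. Qed.

Let A := conj_mx K lam_surj.

Let p (g : G) (w : 'rV[K]_d) : 'rV[K]_k := coset_avg geo (defect K lam_surj g) w.

(** Averaging [defectM]: linearity carries [A g1] out of the average, and equivariance turns the
    shift by [g2] into a move of the base point. *)
Let pM g1 g2 w : p (g1 * g2)%g w = p g1 (a g2 w) + p g2 w *m A g1.
Proof.
rewrite /p -(coset_avg_act sN); last by move=> h n Nn; exact: defect_coset.
have -> : coset_avg geo (defect K lam_surj g2) w *m A g1 =
    coset_avg geo (fun h => defect K lam_surj g2 h *m A g1) w.
  exact/esym/(coset_avg_linear sN geo (mulmxr (A g1))).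
rewrite -(coset_avgD sN).
by congr (coset_avg geo _ w); apply/funext => h; exact: defectM.
Qed.

Let pN n w : N n -> p n w = lamK K lam n.
Proof.
move=> Nn; rewrite /p; have -> : defect K lam_surj n = fun=> lamK K lam n.
  by apply/funext => h; exact: defectN.
exact: coset_avg_cst.
Qed.

(* The Seifert fibration: [N] translates the fibres and [G] acts on the base
   through [G / N]. *)
Definition seifert (g : G) (u : 'rV[K]_(k + d)) : 'rV[K]_(k + d) :=
  row_mx (lsubmx u *m A g + p g (rsubmx u)) (a g (rsubmx u)).

Lemma seifertM g h u : seifert (g * h)%g u = seifert g (seifert h u).
Proof.
rewrite /seifert row_mxKl row_mxKr aM pM /A (conj_mxM K sN nN lamM lam_surj nN').
by rewrite mulmxDl mulmxA -!addrA; congr (row_mx (_ + _) _); rewrite addrC.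
Qed.

Lemma seifertN n u : N n ->
  seifert n u = row_mx (lsubmx u + lamK K lam n) (rsubmx u).
Proof.
by move=> Nn; rewrite /seifert /A (conj_mxN K sN nN lamM lam_surj nN') // mulmx1 pN // aN.
Qed.

Lemma seifert_ker n u : (N `&` [set x | lam x = 0]) n -> seifert n u = u.
Proof.
by move=> [Nn /= l0]; rewrite seifertN // /lamK l0 map_mx0 addr0 hsubmxK.
Qed.

Lemma seifert1 u : seifert 1%g u = u.
Proof. by apply: seifert_ker; split; [exact: subg1|exact: (hom_on1 sN lamM)]. Qed.

Lemma seifert_continuous g : continuous (seifert g).
Proof.
apply: continuous_row_mx => u; last first.
  by apply: (@continuous_comp _ _ _ rsubmx (a g) u); [exact: rsubmx_continuous|exact: ac].
have c1 : {for u, continuous (fun u : 'rV[K]_(k + d) => lsubmx u *m A g)}.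
  apply: (@continuous_comp _ _ _ lsubmx (fun x : 'rV[K]_k => x *m A g) u).
    exact: lsubmx_continuous.
  exact: mulmxr_continuous.
have c2 : {for u, continuous (fun u : 'rV[K]_(k + d) => p g (rsubmx u))}.
  apply: (@continuous_comp _ _ _ rsubmx (p g) u); first exact: rsubmx_continuous.
  exact: coset_avg_continuous.
exact: (continuousD c1 c2).
Qed.

Lemma rsubmx_seifert g u : rsubmx (seifert g u) = a g (rsubmx u).
Proof. by rewrite row_mxKr. Qed.

(** Properness on the base determines [g] up to finitely many [f] and an element [m] of [N]. Since
    [m] translates the fibre by a vector of norm at most [M + r], finitely many values of [lam m]
    remain. *)
Lemma seifert_proper (r : K) : exists s : seq G, forall g u,
  `|u| <= r -> `|seifert g u| <= r ->
  exists2 h, h \in s & (N `&` [set x | lam x = 0]) (h^-1 * g)%g.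
Proof.
case: geo => _ _ /(_ r)[s sP] _ _.
have [M M0 HM] := @uniform_norm_bound K _ s _ _ (fun g => seifert g^-1%g) r
  (fun g => @seifert_continuous g^-1%g).
have [vs vsP] := int_row_bounded k (M + r).
have /choice [z zP] v : exists x, N x /\ lam x = v.
  by have [x] := lam_surj v; exists x.
exists [seq (f * z v)%g | f <- s, v <- vs] => g u ur gur.
have [||f fs Nf] := sP g (rsubmx u).
- exact: le_trans (norm_rsubmx u) ur.
- by rewrite -rsubmx_seifert; exact: le_trans (norm_rsubmx _) gur.
set m := (f^-1 * g)%g in Nf; have [Nz lz] := zP (lam m).
exists (f * z (lam m))%g.
  apply/allpairsP; exists (f, lam m); split=> //=; apply: vsP.
  have := HM _ _ fs gur; rewrite -seifertM -/m seifertN // => /row_mx_norm_le[h _].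
  rewrite -[map_mx _ _](addKr (lsubmx u)) addrC.
  apply: le_trans (ler_normD _ _) _; apply: lerD h _.
  by rewrite normrN; exact: le_trans (norm_lsubmx u) ur.
have Nzi := subgV sN Nz.
have -> : ((f * z (lam m))^-1 * g = (z (lam m))^-1 * m)%g by rewrite invgM mulgA.
split; first exact: subgM.
by rewrite /= lamM // (hom_onV sN lamM) // lz addNr.
Qed.

Lemma seifert_cocompact : exists r : K, forall u, exists g, `|seifert g u| <= r.
Proof.
case: geo => _ _ _ [r rP] _; exists (Num.max 1 r) => u.
have [g gr] := rP (rsubmx u).
pose x := lsubmx (seifert g u).
(* Once the base point is bounded, an element of [N] moves every fibre coordinate into the unit
   interval; hence the radius [Num.max 1 r]. *)
have [n Nn ln] := lam_surj (\row_i - Num.floor (x 0 i)).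
exists (n * g)%g; rewrite seifertM seifertN //; apply/row_mx_norm_le; split; last first.
  by rewrite rsubmx_seifert le_max gr orbT.
rewrite le_max; apply/orP; left; apply/row_norm_leP => // i.
rewrite /lamK ln -/x !mxE intrN ger0_norm ?subr_ge0 ?floor_le //.
by rewrite lerBlDl -intrD1 ltW // floorD1_gt.
Qed.

(** Up to [N], such a [g] is one of finitely many [f]. The factor in [N] shifts the fibre parts of
    both images by the same vector, which cancels in the difference. *)
Lemma seifert_fibre_bound (r rho : K) : exists D : K, forall g u v,
  `|u| <= r -> `|v| <= r -> `|a g (rsubmx u)| <= rho ->
  `|lsubmx (seifert g u) - lsubmx (seifert g v)| <= D /\ `|a g (rsubmx v)| <= D.
Proof.
case: geo => _ _ /(_ (Num.max r rho))[s sP] _ _.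
have [M M0 HM] := @uniform_norm_bound K _ s _ _ seifert r (@seifert_continuous).
exists (M + M) => g u v ur vr gur.
have [||f fs Nf] := sP g (rsubmx u).
- by rewrite le_max (le_trans (norm_rsubmx u) ur).
- by rewrite le_max gur orbT.
have E : g = (f * (f^-1 * g))%g by rewrite mulVKg.
have Hl z : lsubmx (seifert g z) =
    lsubmx (seifert f z) + lamK K lam (f^-1 * g)%g *m A f.
  rewrite {1}E seifertM (seifertN _ Nf) /seifert !row_mxKl !row_mxKr mulmxDl.
  by rewrite addrAC.
have Mu := HM _ _ fs ur; have Mv := HM _ _ fs vr.
rewrite !Hl opprD addrACA subrr addr0; split.
  apply: le_trans (ler_normB _ _) _.
  by apply: lerD; [exact: le_trans (norm_lsubmx _) Mu|exact: le_trans (norm_lsubmx _) Mv].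
rewrite E aM (aN _ Nf) -rsubmx_seifert.
by apply: le_trans (le_trans (norm_rsubmx _) Mv) _; rewrite lerDl.
Qed.
End SeifertAction.

Section SeifertStep.
Variables (K : realType) (G : group) (N : set G) (k d : nat).
Variables (lam : G -> 'rV[int]_k) (a : G -> 'rV[K]_d -> 'rV[K]_d).
Hypotheses (sN : subgroup N) (nN : normal_in N setT) (lamM : hom_on N lam).
Hypothesis lam_surj : forall v, exists2 x, N x & lam x = v.
Hypothesis nN' : normal_in (N `&` [set x | lam x = 0]) setT.
Hypothesis geo : geometric_mod N a.

(* The fibre coordinates are rescaled so slowly that the distortion of the fibres,
   which may grow arbitrarily fast with the base point, becomes sublinear in it. *)
Lemma seifert_step : exists b : G -> 'rV[K]_(k + d) -> 'rV[K]_(k + d),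
  geometric_mod (N `&` [set x | lam x = 0]) b.
Proof.
(* The base radius at scale [j] is [j^2], so after slowing, the distortion is of the order of the
   square root of the distance to the origin. *)
have /choice [D DP] : forall j : nat, exists D : K, forall g u v,
    `|u| <= j%:R -> `|v| <= j%:R -> `|a g (rsubmx u)| <= j%:R ^+ 2 ->
    `|lsubmx (seifert lam_surj geo g u) - lsubmx (seifert lam_surj geo g v)| <= D.
  move=> j; have [D DP] := seifert_fibre_bound sN nN lamM lam_surj nN' geo j%:R (j%:R ^+ 2).
  by exists D => g u v ur vr gur; have [] := DP _ _ _ ur vr gur.
pose b0 := seifert lam_surj geo.
pose th (u : 'rV[K]_(k + d)) := row_mx (map_mx (slow D) (lsubmx u)) (rsubmx u).
pose ht (u : 'rV[K]_(k + d)) := row_mx (map_mx (fast D) (lsubmx u)) (rsubmx u).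
have thK : cancel th ht.
  move=> u; rewrite /th /ht row_mxKl row_mxKr -[RHS]hsubmxK; congr row_mx.
  by apply/rowP => i; rewrite !mxE slowK.
have htK : cancel ht th.
  move=> u; rewrite /th /ht row_mxKl row_mxKr -[RHS]hsubmxK; congr row_mx.
  by apply/rowP => i; rewrite !mxE fastK.
have th_cont : continuous th.
  apply: continuous_row_mx; last exact: rsubmx_continuous.
  move=> u; apply: (@continuous_comp _ _ _ lsubmx (map_mx (slow D))).
    exact: lsubmx_continuous.
  by apply: map_mx_continuous; exact: slow_continuous.
have ht_cont : continuous ht.
  apply: continuous_row_mx; last exact: rsubmx_continuous.
  move=> u; apply: (@continuous_comp _ _ _ lsubmx (map_mx (fast D))).
    exact: lsubmx_continuous.
  by apply: map_mx_continuous; exact: fast_continuous.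
have th_bd r : exists2 M : K, 0 <= M & forall u, `|u| <= r -> `|th u| <= M.
  by apply: compact_norm_bounded; [exact: cball_compact|exact: continuous_subspaceT].
have ht_bd r : exists2 M : K, 0 <= M & forall u, `|u| <= r -> `|ht u| <= M.
  by apply: compact_norm_bounded; [exact: cball_compact|exact: continuous_subspaceT].
have b0M := seifertM sN nN lamM lam_surj nN' geo.
exists (fun g u => th (b0 g (ht u))); split.
- split=> [u|g h u]; first by rewrite /b0 seifert1.
  by rewrite /b0 b0M thK.
- split=> [g|g u Ng]; last by rewrite /b0 seifert_ker.
  move=> u; apply: (@continuous_comp _ _ _ ht (fun u => th (b0 g u))); first exact: ht_cont.
  apply: (@continuous_comp _ _ _ (b0 g) th); last exact: th_cont.
  exact: seifert_continuous.
- move=> r; have [M M0 HM] := ht_bd r.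
  have [s sP] := seifert_proper sN nN lamM lam_surj nN' geo M.
  exists s => g u ur gur; apply: (sP g (ht u)); first exact: HM.
  by rewrite -[seifert _ _ _ _]thK; exact: HM.
- have [r rP] := seifert_cocompact sN nN lamM lam_surj nN' geo.
  have [M M0 HM] := th_bd r; exists M => u.
  by have [g gr] := rP (ht u); exists g; exact: HM.
move=> r e e0; have [c0 c00 Hc0] := ht_bd r.
pose c := Num.Def.archi_bound c0.
have Hc u : `|u| <= r -> `|ht u| <= c%:R.
  by move=> /Hc0/le_trans; apply; rewrite ltW // archi_boundP.
case: (geo) => _ _ _ _ /(_ c%:R e e0)[rhoa rhoaP].
have [M HM] := seifert_fibre_bound sN nN lamM lam_surj nN' geo c%:R rhoa.
(* With [s] the square root of the distance [y], the bound [q <= s] yields at once [c <= s],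
   [1 <= s] and [6 <= e * s]. *)
pose q : K := c%:R + 1 + 6 / e.
have q_ge1 : 1 <= q by rewrite /q addrAC lerDr addr_ge0 // divr_ge0 // ltW.
exists (Num.max (q ^+ 2) ((rhoa + M) / e)) => g u v ur vr.
set y := `|th _| => ry.
have y_rho : (rhoa + M) / e <= y by apply: le_trans ry; rewrite le_max lexx orbT.
have y_q : q ^+ 2 <= y by apply: le_trans ry; rewrite le_max lexx.
have y0 : 0 <= y by exact: normr_ge0.
have ay : `|a g (rsubmx (ht u))| <= y.
  by rewrite -(rsubmx_seifert lam_surj geo); have [_] := (row_mx_norm_le _ _ y).1 (lexx y).
pose s := Num.sqrt y; have sE : s ^+ 2 = y by exact: sqr_sqrtr.
have qs : q <= s.
  by rewrite -(@ler_pXn2r _ 2) ?nnegrE ?sqrtr_ge0 ?sE // (le_trans _ q_ge1).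
pose j := (Num.truncn s).+1.
have sj : s < j%:R by exact: truncnS_gt.
have js : j%:R <= s + 1.
  by rewrite /j -addn1 natrD lerD2r truncn_le sqrtr_ge0.
have s0 : 0 <= s by exact: sqrtr_ge0.
have six : 6 <= e * s.
  have : 6 / e <= s by apply: le_trans qs; rewrite /q lerDr addr_ge0.
  by rewrite ler_pdivrMr // mulrC.
have cs : c%:R <= s.
  by apply: le_trans qs; rewrite /q -addrA lerDl addr_ge0 // divr_ge0 // ltW.
have s_ge1 := le_trans q_ge1 qs.
(* The chain is [2 (j + 1) <= 2 s + 4 <= 6 s <= e s^2 = e y]; the factor 2 comes from
   [slow_dist]. *)
have jy : 2 * (j%:R + 1) <= e * y.
  by rewrite -sE expr2 mulrA; clear -six js s_ge1; nra.
rewrite /th opp_row_mx add_row_mx; apply/row_mx_norm_le; split.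
  have ey : 0 <= e * y by rewrite mulr_ge0 // ltW.
  apply/row_norm_leP => // i; rewrite !mxE.
  apply: le_trans (slow_dist _ _ _) _; apply: le_trans jy; rewrite ler_wpM2l //.
  apply: le_trans (slow_bound D j); apply: slow_le.
  have cj : c%:R <= j%:R :> K by exact: le_trans cs (ltW sj).
  have ayj : `|a g (rsubmx (ht u))| <= j%:R ^+ 2.
    by rewrite (le_trans ay) // -sE ler_pXn2r ?nnegrE // ltW.
  have := DP j g _ _ (le_trans (Hc _ ur) cj) (le_trans (Hc _ vr) cj) ayj.
  by apply: le_trans; have := row_norm_coord (lsubmx (b0 g (ht u)) - lsubmx (b0 g (ht v))) i;
     rewrite !mxE.
(* If the first base image is far out, the hypothesis on [a] applies. Otherwise both base images are
   bounded by [rhoa] and [M], and the fibre alone makes [y] large enough to absorb them. *)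
rewrite !rsubmx_seifert; have [small|big] := leP `|a g (rsubmx (ht u))| rhoa.
  have [_ vM] := HM g _ _ (Hc _ ur) (Hc _ vr) small.
  apply: le_trans (ler_normB _ _) _; apply: le_trans (lerD small vM) _.
  by move: y_rho; rewrite ler_pdivrMr // mulrC.
apply: le_trans (rhoaP g _ _ _ _ (ltW big)) _.
- exact: le_trans (norm_rsubmx _) (Hc _ ur).
- exact: le_trans (norm_rsubmx _) (Hc _ vr).
- by rewrite ler_wpM2l // ltW.
Qed.
End SeifertStep.

Lemma geometric_of_series (K : realType) (G : group) (n : nat) (S : nat -> set G) :
  sp_series n S ->
  exists a : G -> 'rV[K]_n -> 'rV[K]_n, geometric_mod [set 1%g] a.
Proof.
move=> hS; pose P N d := exists a : G -> 'rV[K]_d -> 'rV[K]_d, geometric_mod N a.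
apply: (normal_tower_ind hS (P := P)) => [|N k d lam sN nN lamM surj nN' [a geo]].
  (* The tower starts with the trivial quotient [G / G] acting on the point R^0. *)
  exists (fun=> id); split=> //.
  - by split=> // g x; exact: cvg_id.
  - by move=> r; exists [:: 1%g] => g u _ _; exists 1%g; rewrite ?mem_head.
  - by exists 0 => u; exists 1%g; rewrite (_ : u = 0) ?normr0 //; apply/rowP => -[].
  - move=> r e e0; exists 0 => g u v _ _ _.
    by rewrite (_ : u = v) ?subrr ?normr0 ?mulr_ge0 // ?(ltW e0) //; apply/rowP => -[].
exact: seifert_step geo.
Qed.

(** * The closed ball compactification *)

(* Normed-module instances are found on an abstract [realType] but not on [R]. *)
Definition Kr : realType := R.

(** Around each point of one closed set take a ball of radius at most half its distance to the
    other. Two intersecting balls from opposite sides would have centres closer than the sum of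
    their radii, which is impossible. *)
Lemma metrizable_normal (M : topologicalType) : metrizable M -> normal_space M.
Proof.
move=> [d [d0 [dE [dC [dT dO]]]]]; apply/(@normal_openP Kr) => A B clA clB AB.
have far (X Y : set M) : closed Y -> X `&` Y = set0 -> forall x, X x ->
    exists2 e : R, 0 < e & forall y, Y y -> 2 * e <= d x y.
  move=> clY XY x Xx.
  have /(dO _).1 /(_ x) [|e e0 sub] : open (~` Y) by exact: closed_openC.
    by move=> Yx; have : set0 x by rewrite -XY.
  exists (e / 2) => [|y Yy]; first by rewrite divr_gt0.
  by rewrite mulrC divfK ?pnatr_eq0 // leNgt; apply/negP => /sub.
pose nb (X Y : set M) := [set z | exists x (e : R), [/\ X x, 0 < e, d x z < e &
  forall y, Y y -> 2 * e <= d x y]].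
have opn X Y : open (nb X Y).
  apply/(dO _).2 => z [x [e [Xx e0 xz h]]]; exists (e - d x z); first by rewrite subr_gt0.
  move=> w /= zw; exists x, e; split=> //; apply: le_lt_trans (dT _ z _) _.
  by rewrite addrC -ltrBrDr.
have sub X Y : closed Y -> X `&` Y = set0 -> X `<=` nb X Y.
  move=> clY XY x Xx; have [e e0 h] := far _ _ clY XY _ Xx.
  by exists x, e; split=> //; rewrite (dE x x).2.
exists (nb A B), (nb B A); split => //; [exact: sub|by apply: sub; rewrite 1?setIC|].
rewrite -subset0 => z [[x [e [Ax e0 xz h]]] [y [e' [By e'0 yz h']]]].
have := h _ By; have := h' _ Ax; have := dT x z y.
rewrite (dC z y) (dC y x) => t1 t2 t3.
clear -t1 t2 t3 xz yz; lra.
Qed.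

Section Ball.
Variable n : nat.

(** The norm is the maximum norm, so geometrically this is a cube; the comparison with the Euclidean
    sphere is made in [bdry_sphere]. *)
Definition Ball := set_type [set v : 'rV[Kr]_n | `|v| <= 1].

Definition bval (y : Ball) : 'rV[Kr]_n := \val y.

Lemma bval_le1 (y : Ball) : `|bval y| <= 1.
Proof. exact: set_mem (valP y). Qed.

Definition clamp (v : 'rV[Kr]_n) : 'rV[Kr]_n := (Num.max 1 `|v|)^-1 *: v.

Lemma clamp_le1 v : `|clamp v| <= 1.
Proof.
have m0 : 0 < Num.max 1 `|v| by rewrite lt_max ltr01.
by rewrite normrZ gtr0_norm ?invr_gt0 // ler_pdivrMl // mulr1 le_max lexx orbT.
Qed.

Definition bproj (v : 'rV[Kr]_n) : Ball :=
  exist (fun x => x \in [set v : 'rV[Kr]_n | `|v| <= 1]) (clamp v)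
    (@mem_set _ [set v : 'rV[Kr]_n | `|v| <= 1] (clamp v) (clamp_le1 v)).

Lemma bvalK (y : Ball) : bproj (bval y) = y.
Proof. by apply: val_inj; rewrite /= /clamp max_l ?invr1 ?scale1r ?bval_le1. Qed.

Lemma bprojK v : `|v| <= 1 -> bval (bproj v) = v.
Proof. by move=> v1; rewrite /bval /= /clamp max_l ?invr1 ?scale1r. Qed.

Lemma bval_continuous : continuous bval.
Proof. exact: initial_continuous. Qed.

Lemma clamp_continuous : continuous clamp.
Proof.
move=> v; have m0 : Num.max 1 `|v| != 0 by rewrite gt_eqF // lt_max ltr01.
apply: (@continuousZ Kr _ _ (fun v : 'rV[Kr]_n => (Num.max 1 `|v|)^-1) id v); last exact: cvg_id.
apply: (@continuousV Kr _ (fun v : 'rV[Kr]_n => Num.max 1 `|v|) v m0).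
apply: (@continuous_max Kr _ (cst 1) (fun v : 'rV[Kr]_n => `|v|)).
  exact: cst_continuous.
exact: norm_continuous.
Qed.

Lemma continuous_ball (T : topologicalType) (f : T -> Ball) :
  continuous (bval \o f) -> continuous f.
Proof. exact: continuous_comp_initial. Qed.

Lemma bproj_continuous : continuous bproj.
Proof. apply: continuous_ball; exact: clamp_continuous. Qed.

Lemma Ball_compact : compact [set: Ball].
Proof.
have -> : [set: Ball] = bproj @` [set v | `|v| <= 1].
  by apply/seteqP; split=> // y _; exists (bval y); rewrite ?bvalK //; exact: bval_le1.
apply: continuous_compact; last exact: cball_compact.
exact/continuous_subspaceT/bproj_continuous.
Qed.

Lemma Ball_nbhsP (y : Ball) (A : set Ball) : nbhs y A <->
  exists2 e : R, 0 < e & forall z, `|bval y - bval z| < e -> A z.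
Proof.
rewrite -(@nbhs_ballE Kr); split=> [[e e0 h]|[e e0 h]]; exists e => // z.
  by move=> yz; apply: h; rewrite -initial_ballE /= -ball_normE.
by rewrite -initial_ballE /= -ball_normE; exact: h.
Qed.

Lemma Ball_metrizable : metrizable Ball.
Proof.
exists (fun x y => `|bval x - bval y|); split; first by [].
split.
  move=> x y; split=> [/eqP|->]; last by rewrite subrr normr0.
  by rewrite normr_eq0 subr_eq0 => /eqP /val_inj.
split; first by move=> x y; rewrite distrC.
split; first by move=> x y z; rewrite -{1}(subrKA (bval y)); exact: ler_normD.
move=> A; rewrite openE; split=> [h x /h /Ball_nbhsP [e e0 He]|h x /h[e e0 He]].
  by exists e.
by apply/Ball_nbhsP; exists e.
Qed.

Lemma Ball_separable : separable Ball.
Proof.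
exists (range (fun q : 'rV[rat]_n => bproj (map_mx ratr q))).
  by apply: sub_countable (card_image_le _ _) _; exact: countableP.
apply/seteqP; split => // y _ A /=.
rewrite -{1}(bvalK y) => /(@bproj_continuous (bval y)) /nbhs_ballP [e /= e0 He].
have /choice [q qP] : forall i, exists q : rat, `|bval y 0 i - ratr q| < e.
  move=> i; have [|q] := @rat_in_itvoo Kr (bval y 0 i - e) (bval y 0 i + e).
    by rewrite ltrD2l gtrN.
  by rewrite in_itv /= -ltr_distlC => ?; exists q.
exists (bproj (map_mx ratr (\row_i q i))); split; first by exists (\row_i q i).
apply: He; rewrite -ball_normE /=; apply/row_norm_ltP => // i.
by rewrite !mxE.
Qed.

Definition shrink (p : Ball * R) : Ball := bproj ((1 - p.2) *: bval p.1).

Lemma shrink_continuous : continuous shrink.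
Proof.
move=> p; apply: (@continuous_comp _ _ _ (fun p : Ball * Kr => (1 - p.2) *: bval p.1) bproj);
  last exact: bproj_continuous.
apply: cvgZ; last by apply: continuous_comp; [exact: cvg_fst|exact: bval_continuous].
apply: cvgB; [exact: cvg_cst|exact: cvg_snd].
Qed.

Lemma bval_shrink y (t : R) : 0 <= t <= 1 -> bval (shrink (y, t)) = (1 - t) *: bval y.
Proof.
move=> /andP[t0 t1]; rewrite bprojK //= normrZ ger0_norm ?subr_ge0 //.
rewrite mulr_ile1 ?subr_ge0 ?bval_le1 //; lra.
Qed.

Lemma shrink0 y : shrink (y, 0) = y.
Proof. by rewrite /shrink subr0 scale1r bvalK. Qed.

Lemma Ball_contractible : contractible Ball.
Proof.
exists shrink, (bproj 0); split => [||y].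
- exact/continuous_subspaceT/shrink_continuous.
- exact: shrink0.
- by rewrite /shrink subrr scale0r.
Qed.

(** By Tietze's theorem each coordinate of the inverse of the embedding extends to all of [M] with
    values in [[-1, 1]]. The extensions assemble into a retraction defined everywhere. *)
Lemma Ball_ANR : ANR Ball.
Proof.
split; first exact: Ball_metrizable.
move=> M e mM [ce [ie [cle [h he ch]]]].
have nM := metrizable_normal mM.
have ex (i : 'I_n) : exists f : M -> Kr, [/\ {in range e, (fun m => bval (h m) 0 i) =1 f},
    continuous f & forall m, `|f m| <= 1].
  apply: (@continuous_bounded_extension M Kr nM (range e) cle
    (fun m => bval (h m) 0 i) 1) => //.
    move=> m; apply: (@continuous_comp (subspace (range e)) _ _ h
      (fun y => bval y 0 i)); first exact: ch.
    apply: (@continuous_comp _ _ _ bval (fun v : 'rV[Kr]_n => v 0 i)).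
      exact: bval_continuous.
    exact: coord_continuous.
  by move=> m _; apply: le_trans (row_norm_coord _ _) (bval_le1 _).
have /choice [f fP] := ex.
exists setT; split => //; first exact: openT.
pose F m : 'rV[Kr]_n := \row_i f i m.
exists (bproj \o F).
  apply/continuous_subspaceT => m; apply: continuous_comp; last exact: bproj_continuous.
  apply: cvg_row => i; rewrite mxE.
  have [_ + _] := fP i => /(_ m).
  by under [X in _ -> X @ _ --> _]eq_fun do rewrite mxE.
move=> y /=; rewrite -[RHS]bvalK; congr bproj; apply/rowP => i.
have [fe _ _] := fP i.
by rewrite mxE -fe ?he // inE; exists y.
Qed.

Lemma Ball_AR : AR Ball.
Proof.
split; [|exact: Ball_separable|exact: Ball_metrizable|exact: Ball_contractible|
  exact: Ball_ANR].
by move=> y; exists setT; [exact: Ball_compact|exact: filterT].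
Qed.

Definition bdry : set Ball := [set y | `|bval y| = 1].

Lemma bdry_Zset : Zset bdry.
Proof.
split.
  apply: (@closed_comp Ball Kr (fun y => `|bval y|) [set 1]).
    by move=> y _; apply: continuous_comp; [exact: bval_continuous|exact: norm_continuous].
  exact: closed_eq.
exists shrink; split; [|exact: shrink0|].
  exact/continuous_subspaceT/shrink_continuous.
move=> y t /andP[t0 t1]; rewrite /bdry /= bval_shrink ?t1 ?(ltW t0) //.
rewrite normrZ ger0_norm ?subr_ge0 // => h; have := bval_le1 y.
have := normr_ge0 (bval y); nra.
Qed.

(** The Lebesgue number of an open cover. *)
Lemma compact_small_sets (C : set (set Ball)) : (forall U, C U -> open U) ->
    setT `<=` \bigcup_(U in C) U ->
  exists2 e : Kr, 0 < e & forall A : set Ball, A !=set0 ->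
    (forall y z, A y -> A z -> `|bval y - bval z| < e) -> exists2 U, C U & A `<=` U.
Proof.
move=> Cop Ccov.
pose P (e : Kr) y := exists2 U, C U & forall z, `|bval y - bval z| < e -> U z.
have : \forall e \near 0^'+, [set: Ball] `<=` P e.
  apply: (iffLR (compact_near_coveringP _) Ball_compact) => y _.
  have [U CU Uy] := Ccov y I.
  have /Ball_nbhsP[e e0 He] : nbhs y U by apply: open_nbhs_nbhs; split=> //; exact: Cop.
  exists ([set z | `|bval y - bval z| < e / 2], [set d : Kr | d < e / 2]) => /=.
    split; last by apply: nbhs_right_lt; rewrite divr_gt0.
    by apply/Ball_nbhsP; exists (e / 2) => //; rewrite divr_gt0.
  move=> [z d] [/= yz de]; exists U => // w zw; apply: He.
  rewrite -(subrKA (bval z)); apply: le_lt_trans (ler_normD _ _) _.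
  by rewrite [e]splitr ltrD // (lt_trans zw).
move=> H; have : \forall e \near 0^'+, 0 < e /\ [set: Ball] `<=` P e.
  by apply: filterI H; exact: nbhs_right_gt.
move=> /filter_ex [e [e0 He]]; exists e => // A [y Ay] dA.
by have [U CU HU] := He y I; exists U => // z Az; apply: HU; exact: dA.
Qed.
End Ball.

(** * Euclidean space as the open ball *)

Section OpenBall.
Variable n : nat.
Local Notation V := 'rV[Kr]_n.

Definition contract (u : V) : V := (1 + `|u|)^-1 *: u.
Definition expand (y : V) : V := (1 - `|y|)^-1 *: y.

Let p1_gt0 (u : V) : 0 < 1 + `|u|.
Proof. by rewrite ltr_pwDl. Qed.

Lemma norm_contract u : `|contract u| = `|u| / (1 + `|u|).
Proof. by rewrite normrZ gtr0_norm ?invr_gt0 // mulrC. Qed.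

Lemma contract_lt1 u : `|contract u| < 1.
Proof. by rewrite norm_contract ltr_pdivrMr // mul1r ltrDr. Qed.

Lemma contractK u : expand (contract u) = u.
Proof.
rewrite /expand norm_contract scalerA -[RHS]scale1r; congr (_ *: _).
by have := p1_gt0 u; move: `|u| => t t0; field; rewrite lt0r_neq0 //= addrK oner_neq0.
Qed.

Lemma expandK y : `|y| < 1 -> contract (expand y) = y.
Proof.
move=> y1; have y0 : 0 < 1 - `|y| by rewrite subr_gt0.
rewrite /contract normrZ gtr0_norm ?invr_gt0 // scalerA -[RHS]scale1r; congr (_ *: _).
by move: `|y| y0 => t t0; field; rewrite lt0r_neq0 //= subrK oner_neq0.
Qed.

Lemma contract_continuous : continuous contract.
Proof.
move=> u; apply: (@continuousZ Kr _ _ (fun u : V => (1 + `|u|)^-1) id u); last exact: cvg_id.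
apply: (@continuousV Kr _ (fun u : V => 1 + `|u|) u); first by rewrite gt_eqF.
apply: (@continuousD Kr Kr _ (cst 1) (fun u : V => `|u|)); first exact: cst_continuous.
exact: norm_continuous.
Qed.

Lemma expand_continuous y : `|y| < 1 -> {for y, continuous expand}.
Proof.
move=> y1; apply: (@continuousZ Kr _ _ (fun u : V => (1 - `|u|)^-1) id y); last exact: cvg_id.
apply: (@continuousV Kr _ (fun u : V => 1 - `|u|) y); first by rewrite gt_eqF // subr_gt0.
apply: (@continuousB Kr Kr _ (cst 1) (fun u : V => `|u|)); first exact: cst_continuous.
exact: norm_continuous.
Qed.

(** The denominator is the point: a distance that is sublinear in the norm of [u] becomes small
    after compactification. *)
Lemma contract_dist (u v : V) : `|contract u - contract v| <= 2 * `|u - v| / (1 + `|u|).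
Proof.
have u0 := p1_gt0 u; have v0 := p1_gt0 v.
have -> : contract u - contract v =
    (1 + `|u|)^-1 *: ((u - v) + ((`|v| - `|u|) / (1 + `|v|)) *: v).
  rewrite /contract scalerDr scalerBr scalerA -!addrA; congr (_ + _).
  rewrite -!scaleNr -scalerDl; congr (_ *: _).
  by field; rewrite !gt_eqF.
rewrite normrZ gtr0_norm ?invr_gt0 // mulrC ler_pM2r ?invr_gt0 //.
apply: le_trans (ler_normD _ _) _; rewrite mulr_natl mulr2n lerD2l normrZ.
rewrite normrM [X in _ * X * _]gtr0_norm ?invr_gt0 // -mulrA.
apply: (@le_trans _ _ (`| `|v| - `|u| | * 1)).
  by rewrite ler_wpM2l // ler_pdivrMl // mulr1 lerDr.
by rewrite mulr1 [X in _ <= X]distrC; exact: ler_dist_dist.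
Qed.
End OpenBall.

(** * The induced action on the closed ball and its boundary sphere *)

Section Compactify.
Variables (G : group) (n : nat) (a : G -> 'rV[Kr]_n -> 'rV[Kr]_n).
Hypothesis geo : geometric_mod [set 1%g] a.

Let a1 x : a 1%g x = x. Proof. by case: geo => [[]]. Qed.
Let aM g h x : a (g * h)%g x = a g (a h x). Proof. by case: geo => [[]]. Qed.
Let ac g : continuous (a g). Proof. by case: geo => [_ []]. Qed.

(** The action [a] transported to the open ball. On the boundary [expand] takes the default value 0,
    since the inverse of 0 is 0. *)
Definition ball_act (g : G) (y : Ball n) : Ball n :=
  bproj (contract (a g (expand (bval y)))).

Let X : set (Ball n) := ~` @bdry n.

Let XE y : X y <-> `|bval y| < 1.
Proof.
rewrite lt_neqAle bval_le1 andbT; split=> [/eqP//|/eqP]; exact.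
Qed.

Let bval_act g y : bval (ball_act g y) = contract (a g (expand (bval y))).
Proof. by rewrite bprojK // ltW // contract_lt1. Qed.

Let expand_act g y : expand (bval (ball_act g y)) = a g (expand (bval y)).
Proof. by rewrite bval_act contractK. Qed.

Let expand_bval_continuous y : X y -> {for y, continuous (@expand n \o @bval n)}.
Proof.
move=> /XE y1; apply: continuous_comp; first exact: bval_continuous.
exact: expand_continuous.
Qed.

Let compact_expand K : compact K -> K `<=` X ->
  exists2 r : Kr, 0 <= r & forall y, K y -> `|expand (bval y)| <= r.
Proof.
move=> cK KX; apply: (@compact_norm_bounded Kr _ _ K (@expand n \o @bval n)) => //.
by apply: continuous_in_subspaceT => y /set_mem /KX; exact: expand_bval_continuous.
Qed.

Lemma ball_act_action : action_on X ball_act.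
Proof.
split=> [g y _|g|y Xy|g h y Xy].
- by apply/XE; rewrite bval_act contract_lt1.
- apply: continuous_in_subspaceT => y /set_mem Xy.
  apply: (@continuous_comp _ _ _ (@expand n \o @bval n) (fun v => bproj (contract (a g v)))).
    exact: expand_bval_continuous.
  apply: (@continuous_comp _ _ _ (a g) (fun v => bproj (contract v))); first exact: ac.
  apply: continuous_comp; first exact: contract_continuous.
  exact: bproj_continuous.
- by rewrite /ball_act a1 expandK ?bvalK //; apply/XE.
- by rewrite /ball_act aM -/(ball_act h y) expand_act.
Qed.

Lemma ball_act_proper : proper_action X ball_act.
Proof.
move=> K cK KX; have [r r0 Kr'] := compact_expand cK KX.
case: geo => _ _ /(_ r)[s sP] _ _.
apply: sub_finite_set (finite_seq s) => g [y Ky Kgy] /=.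
have [||h hs] := sP g (expand (bval y)); first exact: Kr'.
  by rewrite -expand_act; exact: Kr'.
by move=> /mulg1_eq; rewrite invgK => <-.
Qed.

(** A closed ball of R^n meets every orbit. Finitely many members of the cover contain its image,
    and their invariance spreads them over [X]. *)
Lemma ball_act_cocompact : cocompact_action X ball_act.
Proof.
move=> C Cop Ccov; case: geo => _ _ _ [r rP] _.
pose q (v : 'rV[Kr]_n) : Ball n := bproj (contract v).
have qX v : X (q v).
  by apply/XE; rewrite bprojK ?contract_lt1 // ltW // contract_lt1.
have qc : continuous q.
  move=> v; apply: continuous_comp; first exact: contract_continuous.
  exact: bproj_continuous.
have /choice [V VP] : forall U, exists V, C U -> open V /\ U = V `&` X.
  move=> U; have [CU|nCU] := pselect (C U); last by exists set0.
  by have [[V oV ->] _] := Cop _ CU; exists V.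
have := @cball_compact Kr n r; rewrite compact_cover.
move=> /(_ _ C (fun U => q @^-1` V U)) [U CU|v vr|D DC Dcov].
- by apply: open_comp (VP _ CU).1 => v _; exact: qc.
- have [U CU Uv] := Ccov _ (qX v); exists U => //.
  by move: Uv; have [_ {1}->] := VP _ CU; case.
- exists [set` D]; split; [exact: finite_fset|by move=> U /DC /set_mem|].
  move=> y Xy; have [g gr] := rP (expand (bval y)).
  have [U DU VU] := Dcov _ gr.
  exists U => //; have CU : C U by apply/set_mem/DC.
  have Ug : U (ball_act g y) by rewrite (VP _ CU).2; split; [exact: VU|exact: qX].
  have -> : y = ball_act g^-1%g (ball_act g y).
    by rewrite /ball_act expand_act -aM mulVg a1 expandK ?bvalK //; apply/XE.
  exact: (Cop _ CU).2.
Qed.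

(** By properness all but finitely many [g] carry the whole of [K] far out, where sublinearity and
    [contract_dist] bring the diameter of the translate below a Lebesgue number of the cover. *)
Lemma ball_act_null K : compact K -> K `<=` X ->
  null_family [set A | exists g, A = ball_act g @` K].
Proof.
move=> cK KX C Cop Ccov; have [r r0 Kr'] := compact_expand cK KX.
have [e e0 He] := compact_small_sets Cop Ccov.
have [[y0 Ky0]|K0] := pselect (K !=set0); last first.
  apply: sub_finite_set (finite_set1 (set0 : set (Ball n))) => A [[g ->] _] /=.
  by rewrite -subset0 => z [y Ky _]; apply: K0; exists y.
case: geo => _ _ pr _ /(_ r (e / 4)) [|rho rhoP]; first by rewrite divr_gt0.
have [s sP] := pr (Num.max r rho).
apply: sub_finite_set (finite_image (fun g => ball_act g @` K) (finite_seq s)).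
move=> A [[g ->] nC]; exists g => //=; apply: contrapT => gs; apply: nC.
apply: He; first by exists (ball_act g y0), y0.
move=> _ _ [y Ky <-] [z Kz <-]; rewrite !bval_act.
set u := a g _; set v := a g _; apply: le_lt_trans (contract_dist u v) _.
have big : rho <= `|u|.
  rewrite leNgt; apply/negP => lt; apply: gs.
  have [||h hs] := sP g (expand (bval y)).
  - by rewrite le_max Kr'.
  - by rewrite le_max (ltW lt) orbT.
  - by move=> /mulg1_eq; rewrite invgK => <-.
have := rhoP g _ _ (Kr' _ Ky) (Kr' _ Kz) big; rewrite -/u -/v => d.
have u0 := normr_ge0 u; rewrite ltr_pdivrMr ?ltr_pwDl //.
clear -d u0 e0; nra.
Qed.

Let nrm2 m (v : 'rV[Kr]_m) : Kr := Num.sqrt (\sum_(i < m) (v ord0 i) ^+ 2).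

Let nrm2_continuous m : continuous (@nrm2 m).
Proof.
move=> v; apply: (@continuous_comp 'rV[Kr]_m Kr Kr
  (fun v => \sum_(i < m) (v ord0 i) ^+ 2) Num.sqrt v); last exact: sqrt_continuous.
apply: (@continuous_sum_for Kr _ Kr) => i.
apply: (@continuous_comp 'rV[Kr]_m Kr Kr (fun v => v ord0 i)
  (fun x : Kr => x ^+ 2)); first exact: coord_continuous.
exact: exprn_continuous.
Qed.

Let nrm2Z m (c : Kr) (v : 'rV[Kr]_m) : 0 <= c -> nrm2 (c *: v) = c * nrm2 v.
Proof.
move=> c0; rewrite /nrm2; under eq_bigr do rewrite mxE exprMn.
by rewrite -mulr_sumr sqrtrM ?sqr_ge0 // sqrtr_sqr ger0_norm.
Qed.

Let nrm2_gt0 m (v : 'rV[Kr]_m) : `|v| != 0 -> 0 < nrm2 v.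
Proof.
rewrite normr_eq0 => /rV0Pn [i vi]; rewrite sqrtr_gt0 (bigD1 i) //=.
by rewrite ltr_pwDl ?sumr_ge0 // ?exprn_even_gt0 // => j _; rewrite sqr_ge0.
Qed.

(** Radial projection between the unit spheres of the maximum norm and of the Euclidean norm [nrm2].
    For [n = 0] both are empty. *)
Lemma bdry_sphere : homeomorphic_sets (@bdry n) (sphere n).
Proof.
pose f (y : Ball n) : 'rV[Kr]_n := (nrm2 (bval y))^-1 *: bval y.
pose g (v : 'rV[Kr]_n) : Ball n := bproj (`|v|^-1 *: v).
have sph (v : 'rV[Kr]_n) : sphere n v <-> nrm2 v = 1.
  split=> [/= h|h]; first by rewrite /nrm2 h sqrtr1.
  rewrite /sphere /= -[LHS]sqr_sqrtr ?h ?expr1n //; first by rewrite -/(nrm2 v) h expr1n.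
  by apply: sumr_ge0 => i _; rewrite sqr_ge0.
have sph0 (v : 'rV[Kr]_n) : sphere n v -> `|v| != 0.
  move=> /sph h; rewrite normr_eq0; apply/eqP => v0; move: h; rewrite v0.
  by rewrite -(scale0r 0) nrm2Z // mul0r => /esym/eqP; rewrite oner_eq0.
have gval (v : 'rV[Kr]_n) : `|v| != 0 -> bval (g v) = `|v|^-1 *: v.
  by move=> v0; rewrite bprojK // normrZ normfV normr_id mulVf.
have bd0 (y : Ball n) : bdry y -> `|bval y| != 0 by move=> ->; rewrite oner_eq0.
exists f, g; split; first split.
- move=> y By; apply/sph; have y0 := nrm2_gt0 (bd0 _ By).
  by rewrite nrm2Z ?mulVf ?gt_eqF // ltW // invr_gt0.
- move=> v /sph0 v0; rewrite /bdry /= gval // normrZ normfV normr_id mulVf //.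
- move=> y By; have y0 := nrm2_gt0 (bd0 _ By); rewrite /g.
  rewrite normrZ By mulr1 gtr0_norm ?invr_gt0 // invrK scalerA mulfV ?gt_eqF //.
  by rewrite scale1r bvalK.
- move=> v Sv; have v0 := sph0 _ Sv; move/sph: Sv => Sv.
  rewrite /f gval // nrm2Z ?invr_ge0 // Sv mulr1 invrK scalerA mulfV //.
  by rewrite scale1r.
split.
  apply: continuous_in_subspaceT => y /set_mem By.
  apply: (@continuousZ Kr _ _ (fun y => (nrm2 (bval y))^-1) (@bval n) y); last exact: bval_continuous.
  apply: (@continuousV Kr _ (fun y => nrm2 (bval y)) y).
    by rewrite gt_eqF // nrm2_gt0 // bd0.
  by apply: continuous_comp; [exact: bval_continuous|exact: nrm2_continuous].
apply: continuous_in_subspaceT => v /set_mem Sv.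
apply: (@continuous_comp _ _ _ (fun v : 'rV[Kr]_n => `|v|^-1 *: v)); last exact: bproj_continuous.
apply: (@continuousZ Kr _ _ (fun u : 'rV[Kr]_n => `|u|^-1) id v); last exact: cvg_id.
apply: (@continuousV Kr _ (fun u : 'rV[Kr]_n => `|u|) v); first exact: sph0.
exact: norm_continuous.
Qed.

Lemma ball_Z_structure : Z_structure G (@bdry n).
Proof.
split; [exact: Ball_compact|exact: Ball_AR|exact: bdry_Zset|].
exists ball_act; split; [exact: ball_act_action|exact: ball_act_proper|
  exact: ball_act_cocompact|exact: ball_act_null].
Qed.
End Compactify.

Theorem mainTheorem2 :
  (forall G : group, strongly_polycyclic G ->
     exists (Xbar : topologicalType) (Z : set Xbar), Z_structure G Z) /\
  (forall (G : group) (n : nat), hirsch_length G n ->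
     exists (Xbar : topologicalType) (Z : set Xbar),
       Z_structure G Z /\ homeomorphic_sets Z (sphere n)).
Proof.
have main (G : group) (n : nat) : hirsch_length G n ->
    exists (Xbar : topologicalType) (Z : set Xbar),
      Z_structure G Z /\ homeomorphic_sets Z (sphere n).
  move=> [S hS]; have [a geo] := geometric_of_series Kr hS.
  exists (Ball n), (@bdry n); split; first exact: ball_Z_structure geo.
  exact: bdry_sphere.
split=> [G [n /main[Xbar [Z [ZS _]]]]|]; last exact: main.
by exists Xbar, Z.
Qed.
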